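(* Let $G$ be a compact Lie group, $n\ge 1$, and let $C$ be a conjugacy class in $G$ such that $p^2\in Z(G)$ for every $p\in C$ and $C=C^{-1}=\{g\in G: g^{-1}\in C\}$. Let $\mathcal C=(C,\dots,C)$ ($2n$ copies), let $\mathscr M\subset C^{2n}$ be the $\mathcal B_{2n}$-invariant symplectic manifold with form $\omega_{\mathcal C}$ described in the context (with $m=2n$), and let $$\Lambda=\{(p_1,\dots,p_{2n})\in C^{2n} : p_{2n-i+1}=p_i^{-1},\ i=1,\dots,n\}.$$ For $\sigma\in\mathcal B_n$ let $\widetilde\sigma\in\mathcal B_{2n}$ be the extension of $\sigma$ which is trivial on the first $n$ strands (i.e. $\sigma$ is placed on the last $n$ strands). Then for every $\sigma\in\mathcal B_n$, $\Gamma_\sigma=\widetilde\sigma(\Lambda)$ is a Lagrangian submanifold of $\mathscr M$.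
   Context: Let $\mathfrak g$ be the Lie algebra of $G$, equipped with an $\mathrm{Ad}$-invariant positive definite inner product $\bullet$; $Z(G)$ is the center of $G$. Let $\omega$ (resp. $\bar\omega$) be the left-invariant (resp. right-invariant) $\mathfrak g$-valued Maurer--Cartan $1$-form on $G$: $\omega(g\cdot X)=X$, $\bar\omega(X\cdot g)=X$ for $X\in\mathfrak g$, $g\in G$. On $G\times G$ define the $2$-form $\Omega=\frac12\,\omega_1\bullet\bar\omega_2$, i.e. $\Omega(U,V)=\frac12\big(\omega_1(U)\bullet\bar\omega_2(V)-\bar\omega_2(U)\bullet\omega_1(V)\big)$, where the index $j$ denotes pull-back by the projection to the $j$-th factor. Let $r:C^m\to G$, $r(g_1,\dots,g_m)=g_1\cdots g_m$, and $K=r^{-1}(e)$. For $1\le j\le m-1$ let $E_j(g_1,\dots,g_m)=(g_1\cdots g_j,\,g_{j+1})\in G\times G$ and put $\omega_c=-\sum_{j=1}^{m-1}E_j^*\Omega$, a $2$-form on $C^m$. Let $\lambda$ be the left-invariant $3$-form on $G$ with $\lambda_e(x,y,z)=\frac12[x,y]\bullet z$, and $\beta=h(\exp^*\lambda)$, where $h:\Omega^*(\mathfrak g)\to\Omega^{*-1}(\mathfrak g)$ is the standard homotopy operator given by integration along linear paths from the origin, $(h\alpha)_x(v_1,\dots,v_{p-1})=\int_0^1t^{p-1}\alpha_{tx}(x,v_1,\dots,v_{p-1})\,dt$. Let $\widetilde{\mathscr O}\subset\mathfrak g$ be an open $\mathrm{Ad}$-invariant subset, star-shaped with respect to $0\in\widetilde{\mathscr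 O}$, on which $\exp$ is a diffeomorphism onto $\exp(\widetilde{\mathscr O})$; let $\mathscr H=r^{-1}(\exp(\widetilde{\mathscr O}))$ and $\tilde r=\exp^{-1}\circ r:\mathscr H\to\widetilde{\mathscr O}$. On $C$ let $\tau_C$ be the $2$-form $\tau_C(Xp-pX,\,Yp-pY)=\frac12\big(X\bullet \mathrm{Ad}(p)Y-Y\bullet \mathrm{Ad}(p)X\big)$, $p\in C$, $X,Y\in\mathfrak g$. With $f_i$ the projection to the $i$-th factor, define on $\mathscr H$ the $2$-form $\omega_{\mathcal C}=\omega_c-\tilde r^*\beta+\sum_i f_i^*\tau_C$. It is a theorem of Guruprasad--Huebschmann--Jeffrey--Weinstein that there is a $G$-invariant open neighbourhood $\mathscr M$ of $K$ in $\mathscr H$ on which $\omega_{\mathcal C}$ is symplectic. The braid group $\mathcal B_m$ with elementary braids $\sigma_1,\dots,\sigma_{m-1}$ acts from the left on $C^m$ by $\sigma_k(g_1,\dots,g_m)=(g_1,\dots,g_{k-1},\,g_kg_{k+1}g_k^{-1},\,g_k,\,g_{k+2},\dots,g_m)$. One has $r\circ\sigma=r$ for all $\sigma\in\mathcal B_m$. The neighbourhood $\mathscr M$ is chosen of the form $\mathscr M=r^{-1}(U)$, with $U$ an open conjugation-invariant neighbourhood of $e$ in $G$; hence $\mathscr M$ is $\mathcal B_m$-invariant. The embedding $\mathcal B_n\to\mathcal B_{2n}$, $\sigma\mapsto\widetilde\sigma$, sends the elementary braid $\sigma_k$ to $\sigma_{n+k}$. *)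

(* Defs.v *)
From HB Require Import structures.
From mathcomp Require Import all_boot all_order all_algebra.
From mathcomp Require Import all_classical all_reals all_analysis.
From mathcomp Require Import zify.

Set Implicit Arguments.
Unset Strict Implicit.
Unset Printing Implicit Defensive.

Import Order.TTheory GRing.Theory Num.Theory numFieldNormedType.Exports.

Local Open Scope classical_set_scope.
Local Open Scope ring_scope.

(* [f] is C^k on the open set [U]. All model spaces below are finite
   dimensional, so it is enough to require every directional derivative of [f]
   to be C^(k-1). *)
Fixpoint Ck (R : realType) (E F : normedModType R) (k : nat) (U : set E)
    (f : E -> F) : Prop :=
  match k with
  | 0 => forall x, U x -> continuous_at x f
  | k'.+1 => (forall x, U x -> differentiable f x) /\
             (forall v : E, Ck k' U (fun x => 'd f x v))
  end.

(* A choice, for each point [p], of a chart around [p] (domain, chart, inverse)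
   with values in the model space [E]. The tangent space at [p] is represented
   by [E] itself: a tangent vector is given by its coordinates in the chart
   chosen at [p]. *)
Record charts (R : realType) (E : normedModType R) (M : Type) := Charts {
  chart_dom : M -> set M ;
  chart : M -> M -> E ;
  chart_inv : M -> E -> M
}.

Section Smooth.
Variables (R : realType).

Record smooth_manifold (E : normedModType R) (M : topologicalType)
    (A : charts E M) : Prop := SmoothManifold {
  manifold_hausdorff : hausdorff_space M ;
  manifold_countable : @second_countable M ;
  chart_center : forall p, chart_dom A p p ;
  chart_dom_open : forall p, open (chart_dom A p) ;
  chart_img_open : forall p, open (chart A p @` chart_dom A p) ;
  chartK : forall p q, chart_dom A p q -> chart_inv A p (chart A p q) = q ;
  chart_continuous : forall p q, chart_dom A p q ->
    continuous_at q (chart A p) ;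
  chart_inv_continuous : forall p x, (chart A p @` chart_dom A p) x ->
    continuous_at x (chart_inv A p) ;
  chart_compatible : forall p q k,
    Ck k (chart A p @` (chart_dom A p `&` chart_dom A q))
      (chart A q \o chart_inv A p)
}.

Definition vec_charts (E : normedModType R) : charts E E :=
  Charts (fun _ => setT) (fun _ => id) (fun _ => id).

Definition prod_charts (E F : normedModType R) (M N : Type)
    (A : charts E M) (B : charts F N) : charts (E * F)%type (M * N)%type :=
  Charts
    (fun p => [set q | chart_dom A p.1 q.1 /\ chart_dom B p.2 q.2])
    (fun p q => (chart A p.1 q.1, chart B p.2 q.2))
    (fun p x => (chart_inv A p.1 x.1, chart_inv B p.2 x.2)).

(* The power M^m is {ptws 'I_m -> M}, i.e. functions with the product topology;
   the i-th component of a tangent vector is the i-th row of a matrix. *)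
Definition pow_charts (d : nat) (M : topologicalType) (A : charts 'rV[R]_d M)
    (m : nat) : charts 'M[R]_(m, d) {ptws 'I_m -> M} :=
  Charts
    (fun p => [set q | forall i, chart_dom A (p i) (q i)])
    (fun p q => \matrix_(i < m) chart A (p i) (q i))
    (fun p x => fun i => chart_inv A (p i) (row i x)).

Section Maps.
Variables (E F : normedModType R).

Definition in_charts (M N : Type) (A : charts E M) (B : charts F N)
    (f : M -> N) (p : M) : E -> F :=
  fun x => chart B (f p) (f (chart_inv A p x)).

Definition smooth_on (M N : topologicalType) (A : charts E M) (B : charts F N)
    (U : set M) (f : M -> N) : Prop :=
  forall p, U p -> continuous_at p f /\
    exists V : set E, [/\ open V, V (chart A p p) &
                          forall k, Ck k V (in_charts A B f p)].

Definition mdiff (M N : Type) (A : charts E M) (B : charts F N)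
    (f : M -> N) (p : M) : E -> F :=
  'd (in_charts A B f p) (chart A p p).

Definition pullback (M N : Type) (A : charts E M) (B : charts F N)
    (f : M -> N) (w : N -> F -> F -> R) : M -> E -> E -> R :=
  fun p u v => w (f p) (mdiff A B f p u) (mdiff A B f p v).

End Maps.

Section Submanifold.
Variables (E : normedModType R) (N : topologicalType) (A : charts E N).

(* [phi] is an injective immersion of the open set [V] of R^k, and a
   homeomorphism onto an open subset of [S] (for the topology induced by [N]) *)
Definition local_param (S : set N) (k : nat) (V : set 'rV[R]_k)
    (phi : 'rV[R]_k -> N) : Prop :=
  [/\ open V,
      smooth_on (vec_charts 'rV[R]_k) A V phi,
      forall x, V x -> injective (mdiff (vec_charts 'rV[R]_k) A phi x),
      {in V &, injective phi} &
      forall V' : set 'rV[R]_k, open V' -> V' `<=` V ->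
        exists2 W : set N, open W & phi @` V' = S `&` W].

Definition submanifold (S : set N) : Prop :=
  exists k : nat, forall p, S p ->
    exists V (phi : 'rV[R]_k -> N), local_param S V phi /\ (phi @` V) p.

Definition tangent (S : set N) (p : N) : set E :=
  [set u | exists (e : R) (c : R^o -> N),
    [/\ 0 < e, smooth_on (vec_charts R^o) A [set t | `|t| < e] c, c 0 = p,
        forall t : R, `|t| < e -> S (c t) &
        u = mdiff (vec_charts R^o) A c 0 1]].

Definition two_form_on (S : set N) (w : N -> E -> E -> R) : Prop :=
  (forall p, S p ->
    (forall (a : R) u v z, tangent S p u -> tangent S p v -> tangent S p z ->
       w p (a *: u + v) z = a * w p u z + w p v z) /\
    (forall u v, tangent S p u -> tangent S p v -> w p u v = - w p v u)) /\
  (forall k V (phi : 'rV[R]_k -> N), local_param S V phi ->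
    forall u v : 'rV[R]_k,
      smooth_on (vec_charts 'rV[R]_k) (vec_charts R^o) V
        (fun x => pullback (vec_charts 'rV[R]_k) A phi w x u v)).

(* d w = 0, where d is computed in the local coordinates of [S] *)
Definition closed_form_on (S : set N) (w : N -> E -> E -> R) : Prop :=
  forall k V (phi : 'rV[R]_k -> N), local_param S V phi ->
    forall x, V x -> forall u v z : 'rV[R]_k,
      let w' a b :=
        (fun y => pullback (vec_charts 'rV[R]_k) A phi w y a b) : _ -> R^o in
      'D_u (w' v z) x + 'D_v (w' z u) x + 'D_z (w' u v) x = 0.

Definition nondegenerate_on (S : set N) (w : N -> E -> E -> R) : Prop :=
  forall p u, S p -> tangent S p u ->
    (forall v, tangent S p v -> w p u v = 0) -> u = 0.

Definition symplectic_manifold (S : set N) (w : N -> E -> E -> R) : Prop :=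
  [/\ submanifold S, two_form_on S w, closed_form_on S w & nondegenerate_on S w].

Definition lagrangian_submanifold (S : set N) (w : N -> E -> E -> R)
    (L : set N) : Prop :=
  [/\ L `<=` S, submanifold L &
      forall p, L p -> tangent L p =
        [set u | tangent S p u /\ forall v, tangent L p v -> w p u v = 0]].

End Submanifold.
End Smooth.

HB.mixin Record isLieGroup (R : realType) (d : nat) G
    of Group G & Topological G := {
  lie_charts : charts 'rV[R]_d G ;
  lie_manifold : smooth_manifold lie_charts ;
  lie_mul_smooth : smooth_on (prod_charts lie_charts lie_charts) lie_charts
    setT (fun p : G * G => (p.1 * p.2)%g) ;
  lie_inv_smooth : smooth_on lie_charts lie_charts setT (fun g : G => g^-1%g)
}.

#[short(type="lieGroupType")]
HB.structure Definition LieGroup (R : realType) (d : nat) :=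
  {G of isLieGroup R d G & Group G & Topological G}.

Section LieTheory.
Variables (R : realType) (d : nat) (G : lieGroupType R d).

Local Notation "'𝔤'" := 'rV[R]_d.
Local Notation AG := (@lie_charts R d G).
Local Notation Av := (vec_charts _).

Implicit Types (g h : G) (X Y Z : 𝔤).

Definition left_translate g X : 'rV[R]_d :=
  mdiff AG AG (fun h => (g * h)%g) 1%g X.
Definition right_translate X g : 'rV[R]_d :=
  mdiff AG AG (fun h => (h * g)%g) 1%g X.

Definition mc_left g (u : 'rV[R]_d) : 𝔤 :=
  mdiff AG AG (fun h => (g^-1 * h)%g) g u.
Definition mc_right g (u : 'rV[R]_d) : 𝔤 :=
  mdiff AG AG (fun h => (h * g^-1)%g) g u.

Definition Ad g : 𝔤 -> 𝔤 := mdiff AG AG (fun h => (g * h * g^-1)%g) 1%g.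

(* the left invariant vector field g |-> g.X, read in the chart at 1 *)
Definition left_field X (x : 'rV[R]_d) : 'rV[R]_d :=
  let g := chart_inv AG 1%g x in
  mdiff AG Av (chart AG 1%g) g (left_translate g X).

(* the value at 1 of the Lie bracket of left invariant vector fields, in the
   chart at 1 *)
Definition lie_bracket X Y : 𝔤 :=
  let o := chart AG 1%g 1%g in
  'd (left_field Y) o X - 'd (left_field X) o Y.

Definition one_param_subgroup (c : R^o -> G) X : Prop :=
  [/\ smooth_on (vec_charts R^o) AG setT c,
      forall s t : R, c (s + t) = (c s * c t)%g &
      mdiff (vec_charts R^o) AG c 0 1 = X].

Definition lie_exp X : G :=
  xget 1%g [set g | exists2 c, one_param_subgroup c X & c 1 = g].

Definition lie_log (O : set 𝔤) g : 𝔤 := xget 0 [set X | O X /\ lie_exp X = g].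

Definition exp_diffeo (O : set 𝔤) : Prop :=
  [/\ {in O &, injective lie_exp},
      open (lie_exp @` O),
      smooth_on (vec_charts 'rV[R]_d) AG O lie_exp &
      smooth_on AG (vec_charts 'rV[R]_d) (lie_exp @` O) (lie_log O)].

(* on the Lie algebra, the tangent space 'rV[R]_d of G at 1 *)
Record invariant_inner_product := InvariantInnerProduct {
  ip :> 𝔤 -> 𝔤 -> R ;
  ip_linear : forall (a : R) X Y Z, ip (a *: X + Y) Z = a * ip X Z + ip Y Z ;
  ip_sym : forall X Y, ip X Y = ip Y X ;
  ip_pos : forall X, X != 0 -> 0 < ip X X ;
  ip_Ad : forall g X Y, ip (Ad g X) (Ad g Y) = ip X Y
}.

Definition in_center g : Prop := forall h, commute g h.

Definition conjugacy_class (C : set G) : Prop :=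
  exists g, C = [set (h * g * h^-1)%g | h in setT].

Definition conj_invariant (U : set G) : Prop :=
  forall g h, U g -> U (h * g * h^-1)%g.

Definition Ad_invariant (O : set 𝔤) : Prop := forall g X, O X -> O (Ad g X).

Definition star_shaped (O : set 𝔤) : Prop :=
  forall X (t : R), O X -> 0 <= t <= 1 -> O (t *: X).

Variable dot : invariant_inner_product.

Definition Omega (p : G * G) (u v : 'rV[R]_d * 'rV[R]_d) : R :=
  (dot (mc_left p.1 u.1) (mc_right p.2 v.2)
   - dot (mc_right p.2 u.2) (mc_left p.1 v.1)) / 2.

Definition lambda_form g (u v w : 'rV[R]_d) : R :=
  dot (lie_bracket (mc_left g u) (mc_left g v)) (mc_left g w) / 2.

Definition exp_lambda X (u v w : 𝔤) : R :=
  lambda_form (lie_exp X) (mdiff Av AG lie_exp X u) (mdiff Av AG lie_exp X v)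
    (mdiff Av AG lie_exp X w).

Definition homotopy3 (a : 𝔤 -> 𝔤 -> 𝔤 -> 𝔤 -> R) X (u v : 𝔤) : R :=
  \int[lebesgue_measure]_(t in `[0, 1]) (t ^+ 2 * a (t *: X) X u v).

Definition beta : 𝔤 -> 𝔤 -> 𝔤 -> R := homotopy3 exp_lambda.

(* tau_C (Xp - pX, Yp - pY) = (X . Ad(p)Y - Y . Ad(p)X) / 2; the right-hand side
   does not depend on the choice of X and Y *)
Definition conj_gen g (u : 'rV[R]_d) : 𝔤 :=
  xget 0 [set X | u = right_translate X g - left_translate g X].

Definition tau g (u v : 'rV[R]_d) : R :=
  let X := conj_gen g u in let Y := conj_gen g v in
  (dot X (Ad g Y) - dot Y (Ad g X)) / 2.

Section Power.
Variable m : nat.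

Local Notation Gm := ({ptws 'I_m -> G}).
Local Notation AGm := (pow_charts AG m).
Local Notation AG2 := (prod_charts AG AG).

Definition class_pow (C : set G) : set Gm := [set g | forall i, C (g i)].

Definition r_map (g : Gm) : G := (\prod_(i < m) g i)%g.

Definition E_map (j : 'I_m) (g : Gm) : G * G :=
  ((\prod_(i < m | (i < j)%N) g i)%g, g j).

(* the indices are numbered from 0: E_1, ..., E_{m-1} are E_map j for 0 < j *)
Definition omega_c (g : Gm) (u v : 'M[R]_(m, d)) : R :=
  - \sum_(j < m | (0 < j)%N) pullback AGm AG2 (E_map j) Omega g u v.

Definition omega_C (O : set 𝔤) (g : Gm) (u v : 'M[R]_(m, d)) : R :=
  omega_c g u v
  - pullback AGm (vec_charts 'rV[R]_d) (lie_log O \o r_map) beta g u v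
  + \sum_(i < m) pullback AGm AG (fun h : Gm => h i) tau g u v.

End Power.
End LieTheory.

Section Braids.
Variable n : nat.

(* (k, true) is the elementary braid crossing strands k and k + 1, numbered
   from 0, and (k, false) is its inverse *)
Definition braid_word := seq ('I_n.-1 * bool).

Inductive braid_rel : braid_word -> braid_word -> Prop :=
| braid_refl u : braid_rel u u
| braid_sym u v : braid_rel u v -> braid_rel v u
| braid_trans u v w : braid_rel u v -> braid_rel v w -> braid_rel u w
| braid_cat u u' v v' :
    braid_rel u u' -> braid_rel v v' -> braid_rel (u ++ v) (u' ++ v')
| braid_cancel k b : braid_rel [:: (k, b); (k, ~~ b)] [::]
| braid_far (i j : 'I_n.-1) : (i.+1 < j)%N ->
    braid_rel [:: (i, true); (j, true)] [:: (j, true); (i, true)]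
| braid_near (i j : 'I_n.-1) : j = i.+1 :> nat ->
    braid_rel [:: (i, true); (j, true); (i, true)]
              [:: (j, true); (i, true); (j, true)].

Definition braid_eq : rel braid_word := fun u v => `[< braid_rel u v >].

Lemma braid_eq_refl : reflexive braid_eq.
Proof. by move=> u; apply/asboolP; exact: braid_refl. Qed.

Lemma braid_eq_sym : symmetric braid_eq.
Proof. by move=> u v; apply/asboolP/asboolP; exact: braid_sym. Qed.

Lemma braid_eq_trans : transitive braid_eq.
Proof.
move=> v u w /asboolP uv /asboolP vw; apply/asboolP.
exact: braid_trans uv vw.
Qed.

Canonical braid_eq_equiv :=
  EquivRel braid_eq braid_eq_refl braid_eq_sym braid_eq_trans.

Definition braid := {eq_quot braid_eq}%qT.
HB.instance Definition _ := Choice.on braid.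

Definition braid_of (w : braid_word) : braid := (\pi_braid w)%qT.

Definition braid_gen (k : 'I_n.-1) : braid := braid_of [:: (k, true)].

Lemma braid_ofP u v : braid_of u = braid_of v <-> braid_rel u v.
Proof.
split=> [/eqP|uv]; first by rewrite /braid_of eqmodE => /asboolP.
by apply/eqP; rewrite /braid_of eqmodE; apply/asboolP.
Qed.

Lemma braid_reprK (x : braid) : braid_of (repr x) = x.
Proof. exact: reprK. Qed.

Lemma braid_repr_rel w : braid_rel (repr (braid_of w)) w.
Proof. by apply/braid_ofP; exact: braid_reprK. Qed.

Definition word_inv (w : braid_word) : braid_word :=
  rev [seq (l.1, ~~ l.2) | l <- w].

Lemma word_invV w : braid_rel (word_inv w ++ w) [::].
Proof.
elim: w => [|[k b] w IH]; first exact: braid_refl.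
rewrite /word_inv /= rev_cons cat_rcons -cat1s.
apply: braid_trans IH; apply: braid_cat; first exact: braid_refl.
rewrite -[w in X in braid_rel _ X]cat0s -(cat1s (k, b) w) catA.
apply: braid_cat; last exact: braid_refl.
by have := braid_cancel k (~~ b); rewrite negbK.
Qed.

Lemma word_invK w : word_inv (word_inv w) = w.
Proof.
rewrite /word_inv map_rev revK -map_comp -[RHS]map_id.
by apply: eq_map => -[k b] /=; rewrite negbK.
Qed.

Lemma word_inv_rel u v : braid_rel u v -> braid_rel (word_inv u) (word_inv v).
Proof.
move=> uv.
have h : braid_rel (word_inv u ++ v ++ word_inv v) (word_inv u).
  rewrite -[X in braid_rel _ X]cats0; apply: braid_cat; first exact: braid_refl.
  by have := word_invV (word_inv v); rewrite word_invK.
apply: braid_trans (braid_sym h) _.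
rewrite catA -[X in braid_rel _ X]cat0s.
apply: braid_cat; last exact: braid_refl.
apply: braid_trans (word_invV u).
by apply: braid_cat (braid_refl _) _; exact: braid_sym.
Qed.

Definition braid_one : braid := braid_of [::].
Definition braid_mul (x y : braid) : braid := braid_of (repr x ++ repr y).
Definition braid_inv (x : braid) : braid := braid_of (word_inv (repr x)).

Lemma braid_mulE u v : braid_mul (braid_of u) (braid_of v) = braid_of (u ++ v).
Proof. by apply/braid_ofP; apply: braid_cat; exact: braid_repr_rel. Qed.

Lemma braid_invE w : braid_inv (braid_of w) = braid_of (word_inv w).
Proof. by apply/braid_ofP; apply: word_inv_rel; exact: braid_repr_rel. Qed.

Lemma braid_mulA : associative braid_mul.
Proof.
move=> x y z; rewrite -(braid_reprK x) -(braid_reprK y) -(braid_reprK z).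
by rewrite !braid_mulE catA.
Qed.

Lemma braid_mul1 : left_id braid_one braid_mul.
Proof. by move=> x; rewrite -(braid_reprK x) braid_mulE. Qed.

Lemma braid_mul1r : right_id braid_one braid_mul.
Proof. by move=> x; rewrite -(braid_reprK x) braid_mulE cats0. Qed.

Lemma braid_mulV : left_inverse braid_one braid_inv braid_mul.
Proof.
move=> x; rewrite -(braid_reprK x) braid_invE braid_mulE.
by apply/braid_ofP; exact: word_invV.
Qed.

Lemma braid_mulVr : right_inverse braid_one braid_inv braid_mul.
Proof.
move=> x; rewrite -(braid_reprK x) braid_invE braid_mulE.
by apply/braid_ofP; rewrite -{1}(word_invK (repr x)); exact: word_invV.
Qed.

HB.instance Definition _ := isGroup.Build braid
  braid_mulA braid_mul1 braid_mul1r braid_mulV braid_mulVr.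

Lemma strand_lo_subproof (k : 'I_n.-1) : (k < n)%N.
Proof. exact: leq_trans (ltn_ord k) (leq_pred n). Qed.

Lemma strand_hi_subproof (k : 'I_n.-1) : (k.+1 < n)%N.
Proof. by case: n k => [[]|n' k] //=; rewrite ltnS. Qed.

Definition strand_lo (k : 'I_n.-1) : 'I_n := Ordinal (strand_lo_subproof k).
Definition strand_hi (k : 'I_n.-1) : 'I_n := Ordinal (strand_hi_subproof k).

Section Action.
Variable G : groupType.

Definition letter_act (l : 'I_n.-1 * bool) (g : 'I_n -> G) : 'I_n -> G :=
  let: lo := strand_lo l.1 in let: hi := strand_hi l.1 in
  fun i =>
    if i == lo then if l.2 then (g lo * g hi * (g lo)^-1)%g else g hi
    else if i == hi then if l.2 then g lo else ((g hi)^-1 * g lo * g hi)%g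
    else g i.

Definition word_act (w : braid_word) (g : 'I_n -> G) : 'I_n -> G :=
  foldr letter_act g w.

Definition braid_act (x : braid) (g : 'I_n -> G) : 'I_n -> G :=
  word_act (repr x) g.

Lemma word_act_cat u v g : word_act (u ++ v) g = word_act u (word_act v g).
Proof. exact: foldr_cat. Qed.

Lemma strand_lo_neq_hi k : strand_lo k != strand_hi k.
Proof. by rewrite -val_eqE /= neq_ltn ltnSn. Qed.

Lemma letter_actK k b g : letter_act (k, b) (letter_act (k, ~~ b) g) = g.
Proof.
have lh := negbTE (strand_lo_neq_hi k).
have hl : (strand_hi k == strand_lo k) = false by rewrite eq_sym lh.
apply/funext => i; rewrite /letter_act /= !eqxx !hl.
case: b => /=; case: (eqVneq i (strand_lo k)) => [->|_] //.
- by rewrite !mulgA mulgV mul1g mulgK.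
- by case: (eqVneq i (strand_hi k)) => [->|].
- case: (eqVneq i (strand_hi k)) => [->|] //.
  by rewrite !mulgA mulVg mul1g mulgVK.
Qed.

Lemma word_act_rel u v g : braid_rel u v -> word_act u g = word_act v g.
Proof.
move=> uv; elim: uv g => {u v}.
- by [].
- by move=> u v _ IH g; rewrite IH.
- by move=> u v w _ IHu _ IHv g; rewrite IHu IHv.
- by move=> u u' v v' _ IHu _ IHv g; rewrite !word_act_cat IHv IHu.
- by move=> k b g; exact: letter_actK.
- move=> i j ij g; apply/funext => x; rewrite /= /letter_act -!val_eqE /=.
  have [ij0 ij1 ij2] : [/\ (i == j :> nat) = false, (i == j.+1 :> nat) = false
      & (i.+1 == j :> nat) = false] by split; apply/eqP; lia.
  have [ji0 ji1 ji2] : [/\ (j == i :> nat) = false, (j == i.+1 :> nat) = false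
      & (j.+1 == i :> nat) = false] by split; apply/eqP; lia.
  rewrite ?eqSS ?ij0 ?ij1 ?ij2 ?ji0 ?ji1 ?ji2.
  case: (eqVneq (x : nat) i) => [->|_]; first by rewrite ij0 ij1.
  by case: (eqVneq (x : nat) i.+1) => [->|_] //; rewrite eqSS ij2 ij0.
move=> i j ij g; apply/funext => x.
have hij : strand_lo j = strand_hi i by apply: val_inj; rewrite /= ij.
have e1 := strand_lo_neq_hi i; have e2 := strand_lo_neq_hi j.
rewrite hij in e2.
have e3 : strand_lo i != strand_hi j.
  by rewrite -val_eqE /= ij; apply/eqP; lia.
rewrite /= /letter_act /= !hij !eqxx.
rewrite !(eq_sym (strand_hi i) (strand_lo i)) !(eq_sym (strand_hi j)).
rewrite (negbTE e1) (negbTE e2) (negbTE e3).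
case: (eqVneq x (strand_lo i)) => [->|_].
  by rewrite (negbTE e1) (negbTE e3) !mulgA !mulgVK !invgM invgK !mulgA !mulgVK.
case: (eqVneq x (strand_hi i)) => [//|_].
by case: (eqVneq x (strand_hi j)).
Qed.

Lemma braid_act_of w g : braid_act (braid_of w) g = word_act w g.
Proof. by apply: word_act_rel; exact: braid_repr_rel. Qed.

Lemma braid_act_gen k g :
  braid_act (braid_gen k) g = fun i =>
    if i == strand_lo k
    then (g (strand_lo k) * g (strand_hi k) * (g (strand_lo k))^-1)%g
    else if i == strand_hi k then g (strand_lo k) else g i.
Proof. exact: braid_act_of. Qed.

Lemma braid_act1 g : braid_act 1%g g = g.
Proof. exact: braid_act_of. Qed.

Lemma braid_actM x y g : braid_act (x * y)%g g = braid_act x (braid_act y g).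
Proof. by rewrite [LHS]braid_act_of word_act_cat. Qed.

End Action.
End Braids.

Section Shift.
Variable n : nat.

Lemma shift_gen_subproof (k : 'I_n.-1) : (n + k < (2 * n).-1)%N.
Proof. by have := ltn_ord k; lia. Qed.

Definition shift_gen (k : 'I_n.-1) : 'I_(2 * n).-1 :=
  Ordinal (shift_gen_subproof k).

Definition word_shift (w : braid_word n) : braid_word (2 * n) :=
  [seq (shift_gen l.1, l.2) | l <- w].

Definition braid_shift (x : braid n) : braid (2 * n) :=
  braid_of (word_shift (repr x)).

Lemma word_shift_rel u v :
  braid_rel u v -> braid_rel (word_shift u) (word_shift v).
Proof.
elim=> {u v} [u|u v _|u v w _ IHu _|u u' v v' _ IHu _ IHv|k b|i j ij|i j ij].
- exact: braid_refl.
- exact: braid_sym.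
- exact: braid_trans IHu.
- by rewrite /word_shift !map_cat; exact: braid_cat.
- exact: braid_cancel.
- by apply: braid_far; rewrite /= -addnS ltn_add2l.
- by apply: braid_near; rewrite /= ij addnS.
Qed.

Lemma braid_shift_of w : braid_shift (braid_of w) = braid_of (word_shift w).
Proof. by apply/braid_ofP; apply: word_shift_rel; exact: braid_repr_rel. Qed.

Lemma braid_shift_gen k : braid_shift (braid_gen k) = braid_gen (shift_gen k).
Proof. exact: braid_shift_of. Qed.

Lemma braid_shiftM x y :
  braid_shift (x * y)%g = (braid_shift x * braid_shift y)%g.
Proof.
rewrite [LHS](braid_shift_of (repr x ++ repr y)).
by rewrite /word_shift map_cat [RHS]braid_mulE.
Qed.

End Shift.

Definition Lambda (R : realType) (d : nat) (G : lieGroupType R d) (n : nat)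
    (C : set G) : set {ptws 'I_(2 * n) -> G} :=
  [set p | class_pow C p /\
     forall i : 'I_(2 * n), (i < n)%N -> p (rev_ord i) = (p i)^-1%g].

(* Main.v *)
(* Let z be the common square of the elements of C; it is central, so Ad p is an
   involution for p in C. Hence tau vanishes, C is parametrized near p by
   X |-> exp X p with Ad p X = - X, and the tangent space of M at q consists of
   the vectors (X_i q_i) with Ad q_i X_i = - X_i. Where r = 1 the beta term
   vanishes too, since beta is zero at the origin, and omega_C becomes - 1/2 times
   the sum over j of A_j . B_{j+1} - A_{j+1} . B_j, where A_j is the velocity of
   the j-th partial product in the right trivialization. An elementary braid
   changes a single A_j and preserves this sum, so it is enough to treat sigma = 1.
   On Lambda, reflecting the strands gives A_{2n-j} = A_j, which makes the sum
   change sign, so Lambda is isotropic; so is the complement of its tangent space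
   where the reflected velocities are opposite, because there
   A_{2n-j} = A_{2n} - A_j. As omega_C is nondegenerate, Lambda is Lagrangian. *)
Require Import Defs.
From HB Require Import structures.
From mathcomp Require Import all_boot all_order all_algebra.
From mathcomp Require Import all_classical all_reals all_analysis.
From mathcomp Require Import zify ring lra.
Import Order.TTheory GRing.Theory Num.Theory numFieldNormedType.Exports.
Local Open Scope classical_set_scope.
Local Open Scope ring_scope.

Set Implicit Arguments.
Unset Strict Implicit.
Unset Printing Implicit Defensive.

(** * Maps of class C^k *)

Section DiffTheory.
Variable R : realType.
Implicit Types E F H : normedModType R.

(** All differentiation is pushed into algebra. The tangent bundle of G is itself a group,
    [tangent_group], and passing to differentials, [tmap], carries products and inverses of G-valued
    maps to products and inverses there. Hence a braid acts on tangent vectors by the formula by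
    which it acts on points, the equation p^2 = z differentiates to [tangent_root], and the relation
    defining Lambda keeps its form. Facts about partial products are proved for any group and used
    both in G and in its tangent bundle. In the other direction [tangent] is defined by curves, so
    every vector claimed to be tangent needs an explicit curve, built from [lie_exp]. That map is a
    choice with default value 1; that one-parameter subgroups exist is extracted from its
    injectivity on [O], not from solving a differential equation. The sum formula for omega_C holds
    where r = 1 and not on all of M, so braid invariance is shown only at points of Lambda. No
    dimension is counted: the Lagrangian condition is maximality of an isotropic space, which
    nondegeneracy decides. *)

Lemma near_eq_diff E F (f g : E -> F) x :
  (\forall y \near x, f y = g y) -> differentiable f x ->
  differentiable g x /\ 'd g x = 'd f x :> (E -> F).
Proof.
move=> fg df.
have fgx := nbhs_singleton fg.
have e : g \o shift x = cst (g x) + 'd f x +o_ 0 id.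
  have /eqaddoP h := diff_locally df.
  apply/eqaddoP => e e0.
  have fg0 : \forall y \near 0, f (y + x) = g (y + x).
    by move: fg; rewrite (near_shift 0 x) subr0.
  apply: filterS2 (h _ e0) fg0 => y /=.
  rewrite -[(_ - _) y]/(f (y + x) - (f x + 'd f x y)).
  by rewrite -[(g \o _ - _) y]/(g (y + x) - (g x + 'd f x y)) fgx => + <-.
have dg : 'd g x = 'd f x :> (E -> F).
  by apply: (@diff_unique _ _ _ g ('d f x)) => //; exact: diff_continuous.
split => //; apply/diff_locallyP; rewrite dg; split => //.
exact: diff_continuous.
Qed.

Lemma linear_diff E F (f : E -> F) x : linear f -> continuous f ->
  differentiable f x /\ 'd f x = f :> (E -> F).
Proof.
move=> lf cf.
pose fL : {linear E -> F} := HB.pack f (GRing.isLinear.Build _ _ _ _ f lf).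
split; first exact: (@linear_differentiable _ _ _ fL).
exact: (@diff_lin _ _ _ fL).
Qed.

Lemma scale_diff E F (c : E -> R^o) (g : E -> F) x :
  differentiable c x -> differentiable g x ->
  differentiable (fun y => c y *: g y) x /\
  forall v, 'd (fun y => c y *: g y) x v = c x *: 'd g x v + 'd c x v *: g x.
Proof.
move=> dc dg.
pose s (a : R^o) (w : F) : F := a *: w.
have bs : bilinear_for (GRing.Scale.Law.clone _ _ *:%R _)
    (GRing.Scale.Law.clone _ _ *:%R _) s.
  split=> [u'|u] a y z; rewrite /s /=; first by rewrite scalerDl scalerA.
  by rewrite scalerDr !scalerA mulrC.
pose sM := bilinear_isBilinear.Build R _ _ _ _ _ s bs.
pose sL : {bilinear R^o -> F -> F} := HB.pack s sM.
have sc : continuous (fun p : R^o * F => sL p.1 p.2).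
  by move=> p; exact: scale_continuous.
have dp := differentiable_pair dc dg.
have ds := differentiable_bilin (c x, g x) sc.
rewrite (_ : (fun y => c y *: g y) = (fun p => sL p.1 p.2) \o (fun y => (c y, g y))) //.
split; first exact: differentiable_comp.
move=> v; rewrite diff_comp //= diff_pair // (diff_bilin (c x, g x) sc) //=.
Qed.

Lemma Ck_sub E F k (U V : set E) (f : E -> F) :
  U `<=` V -> Ck k V f -> Ck k U f.
Proof.
move=> UV; elim: k f => [|k IH] f /=; first by move=> h x /UV; exact: h.
by move=> [h1 h2]; split => [x /UV|v]; [exact: h1|exact: IH].
Qed.

Lemma Ck_eq E F k (U : set E) (f g : E -> F) : open U ->
  (forall x, U x -> f x = g x) -> Ck k U f -> Ck k U g.
Proof.
move=> oU; elim: k f g => [|k IH] f g fg /=.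
  move=> h x Ux; rewrite /continuous_at -fg //; apply: cvg_trans (h x Ux).
  apply: near_eq_cvg; near=> y; apply: fg; near: y.
  exact: open_nbhs_nbhs.
move=> [h1 h2].
have fgx x : U x -> \forall y \near x, f y = g y.
  by move=> Ux; near=> y; apply: fg; near: y; exact: open_nbhs_nbhs.
split=> [x Ux|v]; first by have [] := near_eq_diff (fgx x Ux) (h1 x Ux).
apply: IH (h2 v) => x Ux.
by have [_ ->] := near_eq_diff (fgx x Ux) (h1 x Ux).
Unshelve. all: by end_near. Qed.

Lemma CkW E F k (U : set E) (f : E -> F) : Ck k.+1 U f -> Ck k U f.
Proof.
elim: k f => [|k IH] f.
  by move=> [h _] x Ux; exact: differentiable_continuous (h x Ux).
by move=> [h1 h2]; split=> // v; exact: IH.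
Qed.

Lemma Ck_cst E F k (U : set E) (a : F) : Ck k U (fun=> a).
Proof.
elim: k a => [|k IH] a /=; first by move=> x _; exact: cvg_cst.
split=> [x _|v]; first exact: differentiable_cst.
by rewrite (_ : (fun x => _) = (fun=> 0)) //; apply/funext => x; rewrite diff_cst.
Qed.

Lemma Ck_linear E F k (U : set E) (f : E -> F) :
  linear f -> continuous f -> Ck k U f.
Proof.
move=> lf cf; case: k => [|k] /=; first by move=> x _; exact: cf.
split=> [x _|v]; first by have [] := linear_diff x lf cf.
rewrite (_ : (fun x => _) = (fun=> f v)); first exact: Ck_cst.
by apply/funext => x; have [_ ->] := linear_diff x lf cf.
Qed.

Lemma CkD E F k (U : set E) (f g : E -> F) : open U ->
  Ck k U f -> Ck k U g -> Ck k U (fun x => f x + g x).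
Proof.
move=> oU; elim: k f g => [|k IH] f g /=.
  by move=> hf hg x Ux; apply: cvgD; [exact: hf|exact: hg].
move=> [f1 f2] [g1 g2]; split=> [x Ux|v].
  by apply: differentiableD; [exact: f1|exact: g1].
apply: (Ck_eq oU _ (IH _ _ (f2 v) (g2 v))) => x Ux.
exact: (congr1 (@^~ v) (esym (diffD (f1 x Ux) (g1 x Ux)))).
Qed.

Lemma CkZ E F k (U : set E) (c : E -> R^o) (g : E -> F) : open U ->
  Ck k U c -> Ck k U g -> Ck k U (fun x => c x *: g x).
Proof.
move=> oU; elim: k c g => [|k IH] c g.
  by move=> hf hg x Ux; apply: cvgZ; [exact: hf|exact: hg].
move=> kc kg; have [c1 c2] := kc; have [g1 g2] := kg.
split=> [x Ux|v]; first by have [] := scale_diff (c1 x Ux) (g1 x Ux).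
have := CkD oU (IH _ _ (CkW kc) (g2 v)) (IH _ _ (c2 v) (CkW kg)).
by apply: Ck_eq => // x Ux; have [_ ->] := scale_diff (c1 x Ux) (g1 x Ux).
Qed.

Lemma Ck_sum E F k (U : set E) n (f : 'I_n -> E -> F) : open U ->
  (forall i, Ck k U (f i)) -> Ck k U (fun x => \sum_(i < n) f i x).
Proof.
move=> oU; elim: n f => [|n IH] f h.
  by under eq_fun do rewrite big_ord0; exact: Ck_cst.
under eq_fun do rewrite big_ord_recr /=.
by apply: CkD => //; apply: (IH (fun i => f (widen_ord (leqnSn n) i))).
Qed.

(* The derivative of a composite, [x |-> 'd g (f x) ('d f x v)], is evaluated at
   a moving vector; expanding that vector in a frame of the middle space turns
   it into a sum of products of maps to which induction applies. *)
Definition finite_frame F := exists n (e : 'I_n -> F) (c : 'I_n -> F -> R^o),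
  [/\ forall i, linear (c i), forall i, continuous (c i) &
      forall x, x = \sum_(i < n) c i x *: e i].

Lemma linear_frame_continuous F H (f : F -> H) :
  finite_frame F -> linear f -> continuous f.
Proof.
move=> [n [e [c [lc cc ec]]]] lf.
pose fL : {linear F -> H} := HB.pack f (GRing.isLinear.Build _ _ _ _ f lf).
rewrite (_ : f = fun x => \sum_(i < n) c i x *: f (e i)).
  move=> x; apply: (@Ck_sum _ _ 0 setT _ _ openT _ x I) => i.
  by apply: (CkZ openT) => y _; [exact: cc|exact: cvg_cst].
apply/funext => x; rewrite {1}(ec x) -[f _]/(fL _) linear_sum.
by apply: eq_bigr => i _; rewrite linearZ.
Qed.

Lemma Ck_comp E F H k (U : set E) (V : set F) (f : E -> F) (g : F -> H) :
  finite_frame F -> open U -> (forall x, U x -> V (f x)) ->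
  Ck k U f -> Ck k V g -> Ck k U (g \o f).
Proof.
move=> fF; have [n [e [c [lc cc ec]]]] := fF.
elim: k E H U V f g => [|k IH] E H U V f g oU UV.
  by move=> hf hg x Ux; apply: continuous_comp; [exact: hf|exact/hg/UV].
move=> kf kg; have [f1 f2] := kf; have [g1 g2] := kg.
split=> [x Ux|v].
  by apply: differentiable_comp; [exact: f1|exact/g1/UV].
have : Ck k U (fun x => \sum_(i < n)
    (c i ('d f x v)) *: ('d g (f x) (e i))).
  apply: Ck_sum => // i; apply: CkZ => //.
    exact: (IH _ _ U setT (fun x => 'd f x v) (c i) oU (fun _ _ => I) (f2 v) (Ck_linear k setT (lc i) (cc i))).
  exact: (IH _ _ U V f (fun y => 'd g y (e i)) oU UV (CkW kf) (g2 (e i))).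
apply: Ck_eq => // x Ux; rewrite (diff_comp (f1 x Ux) (g1 _ (UV x Ux))) /=.
rewrite {2}(ec ('d f x v)) linear_sum.
by apply: eq_bigr => i _; rewrite linearZ.
Qed.

Lemma mx_frame m n : finite_frame 'M[R]_(m, n).
Proof.
pose e (i : 'I_#|{: 'I_m * 'I_n}|) : 'M[R]_(m, n) :=
  delta_mx (enum_val i).1 (enum_val i).2.
exists #|{: 'I_m * 'I_n}|, e,
  (fun i (x : 'M[R]_(m, n)) => x (enum_val i).1 (enum_val i).2); split.
- by move=> i a x y; rewrite !mxE.
- by move=> i; exact: coord_continuous.
- move=> x; rewrite {1}(matrix_sum_delta x) pair_bigA /=.
  rewrite (reindex_onto enum_val enum_rank) /=; last by move=> *; rewrite enum_rankK.
  by apply: eq_bigl => i; rewrite enum_valK eqxx.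
Qed.

Lemma Ro_frame : finite_frame (R^o : normedModType R).
Proof.
exists 1, (fun=> 1), (fun _ x => x); split.
- by [].
- by move=> i x; exact: cvg_id.
- by move=> x; rewrite big_ord1; exact: (esym (mulr1 x)).
Qed.

Lemma prod_frame E F : finite_frame E -> finite_frame F ->
  finite_frame (E * F)%type.
Proof.
move=> [m [e [c [lc cc ec]]]] [n [e' [c' [lc' cc' ec']]]].
exists (m + n)%N, (fun i : 'I_(m + n) => match fintype.split i with inl j => (e j, 0)
  | inr j => (0, e' j) end),
  (fun (i : 'I_(m + n)) (x : E * F) => match fintype.split i with inl j => c j x.1 | inr j => c' j x.2 end).
split.
- by move=> i a x y; case: fintype.split => j; [exact: lc|exact: lc'].
- move=> i; case: fintype.split => j x.
    by apply: (@continuous_comp _ _ _ fst (c j)); [exact: cvg_fst|exact: cc].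
  by apply: (@continuous_comp _ _ _ snd (c' j)); [exact: cvg_snd|exact: cc'].
move=> [x y]; rewrite big_split_ord /=.
under eq_bigr do rewrite (unsplitK (inl _)) /=.
under [X in _ + X]eq_bigr do rewrite (unsplitK (inr _)) /=.
have fstS N (h : 'I_N -> E * F) : (\sum_i h i).1 = \sum_i (h i).1.
  exact: (big_morph fst).
have sndS N (h : 'I_N -> E * F) : (\sum_i h i).2 = \sum_i (h i).2.
  exact: (big_morph snd).
rewrite [RHS]surjective_pairing; congr pair => /=.
  rewrite !fstS /= [X in _ + X]big1 ?addr0 => [|i _]; last exact: scaler0.
  exact: ec.
rewrite !sndS /= [X in X + _]big1 ?add0r => [|i _]; last exact: scaler0.
exact: ec'.
Qed.
End DiffTheory.

(** * Smooth maps between charted spaces *)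

Lemma near_open (T : topologicalType) (p : T) (P : T -> Prop) :
  (\forall x \near p, P x) ->
  exists W : set T, [/\ open W, W p & forall x, W x -> P x].
Proof.
move=> h; exists (interior [set x | P x]).
by split => //; [exact: open_interior|exact: interior_subset].
Qed.

Lemma near_forall (I : finType) (T : topologicalType) (p : T)
    (P : I -> T -> Prop) :
  (forall i, \forall x \near p, P i x) -> \forall x \near p, forall i, P i x.
Proof. by move=> h; exact: (@filter_forall _ _ (fun i => [set x | P i x])). Qed.

Section ChartCalculus.
Variable R : realType.

(** Only the chart centred at [p] enters, because tangent vectors at [p] are read in that chart
    alone. These local conditions pass directly to product and power charts, whereas the atlas
    conditions of [smooth_manifold] are given for G itself. *)
Record regular_chart (E : normedModType R) (M : topologicalType)
    (A : charts E M) (p : M) : Prop := RegularChart {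
  regular_frame : finite_frame E ;
  regular_continuous : continuous_at p (chart A p) ;
  regular_inv_continuous : continuous_at (chart A p p) (chart_inv A p) ;
  regular_chartK : \forall q \near p, chart_inv A p (chart A p q) = q ;
  regular_invK : \forall x \near chart A p p, chart A p (chart_inv A p x) = x
}.

Definition smooth_at (E F : normedModType R) (M N : topologicalType)
    (A : charts E M) (B : charts F N) (f : M -> N) (p : M) : Prop :=
  continuous_at p f /\ exists V : set E, [/\ open V, V (chart A p p) &
    forall k, Ck k V (in_charts A B f p)].

Section Regular.
Variables (E : normedModType R) (M : topologicalType) (A : charts E M) (p : M).
Hypothesis rA : regular_chart A p.

Lemma chart_inv_center : chart_inv A p (chart A p p) = p.
Proof. exact: nbhs_singleton (regular_chartK rA). Qed.

Lemma near_chart_inv (P : set M) : (\forall q \near p, P q) ->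
  \forall x \near chart A p p, P (chart_inv A p x).
Proof.
move=> h; have := regular_inv_continuous rA.
rewrite /continuous_at chart_inv_center; exact.
Qed.

End Regular.

Lemma smooth_manifold_regular (E : normedModType R) (M : topologicalType)
    (A : charts E M) p :
  finite_frame E -> smooth_manifold A -> regular_chart A p.
Proof.
move=> fE [_ _ cen oD oI K cc ci _]; split => //.
- exact: (cc _ _ (cen p)).
- by apply: ci; exists p => //; exact: cen.
- apply: filterS (K p) _; exact: open_nbhs_nbhs (conj (oD p) (cen p)).
- have I : nbhs (chart A p p) (chart A p @` chart_dom A p).
    apply: open_nbhs_nbhs; split; first exact: oI.
    by exists p => //; exact: cen.
  by apply: filterS I => x [q Dq <-]; rewrite K.
Qed.

Lemma vec_regular (E : normedModType R) (x : E) :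
  finite_frame E -> regular_chart (vec_charts E) x.
Proof. by move=> fE; split => //; exact: nearW. Qed.

Section Comp.
Variables (E F : normedModType R) (M N : topologicalType).
Variables (A : charts E M) (B : charts F N).

Lemma smooth_at_diff (f : M -> N) p : smooth_at A B f p ->
  differentiable (in_charts A B f p) (chart A p p).
Proof. by move=> [_ [V [oV Vp /(_ 1)]]] [+ _]; exact. Qed.

Lemma smooth_at_near (f g : M -> N) p : regular_chart A p ->
  (\forall q \near p, f q = g q) -> smooth_at A B f p ->
  smooth_at A B g p /\ mdiff A B g p = mdiff A B f p.
Proof.
move=> rA fg sf; have [cf [V [oV Vp kV]]] := sf.
have fgp := nbhs_singleton fg.
have fgx : \forall x \near chart A p p,
    in_charts A B f p x = in_charts A B g p x.
  by apply: filterS (near_chart_inv rA fg) => x; rewrite /in_charts fgp => ->.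
split; last first.
  by have [_] := near_eq_diff fgx (smooth_at_diff sf).
split.
  rewrite /continuous_at -fgp; apply: cvg_trans cf.
  by apply: near_eq_cvg; apply: filterS fg.
have [W [oW Wp Wfg]] := near_open fgx.
exists (V `&` W); split; [exact: openI| by []|].
move=> k; apply: (@Ck_eq _ _ _ _ _ (in_charts A B f p)); first exact: openI.
  by move=> x [_ /Wfg].
by apply: Ck_sub (kV k) => x [].
Qed.

Lemma smooth_at_cst (a : N) p : smooth_at A B (fun=> a) p.
Proof.
split; first exact: cvg_cst.
by exists setT; split => // [|k]; [exact: openT|exact: Ck_cst].
Qed.

Lemma mdiff_cst (a : N) p u : mdiff A B (fun=> a) p u = 0.
Proof. by rewrite /mdiff /in_charts diff_cst. Qed.

End Comp.

Lemma smooth_at_id (E : normedModType R) (M : topologicalType)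
    (A : charts E M) p : regular_chart A p ->
  smooth_at A A id p /\ forall u, mdiff A A id p u = u.
Proof.
move=> rA; have h := regular_invK rA.
have e : \forall x \near chart A p p, id x = in_charts A A id p x.
  by apply: filterS h => x; rewrite /in_charts => ->.
split; last first.
  have [did eid] : is_diff (chart A p p) (@id E) id by exact: is_diff_id.
  by move=> u; have [_ ] := near_eq_diff e did; rewrite eid /mdiff => ->.
split; first exact: cvg_id.
have [W [oW Wp We]] := near_open e.
exists W; split => // k; apply: (Ck_eq oW We).
apply: Ck_linear => // x; exact: cvg_id.
Qed.

Section Comp3.
Variables (E F H : normedModType R) (M N P : topologicalType).
Variables (A : charts E M) (B : charts F N) (C : charts H P).

Lemma smooth_at_comp (f : M -> N) (g : N -> P) p :
  regular_chart A p -> regular_chart B (f p) ->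
  smooth_at A B f p -> smooth_at B C g (f p) ->
  smooth_at A C (g \o f) p /\
  forall u, mdiff A C (g \o f) p u = mdiff B C g (f p) (mdiff A B f p u).
Proof.
move=> rA rB sf sg; have [cf [V [oV Vp kV]]] := sf.
have [cg [W [oW Wp kW]]] := sg.
(* The chart at [f p] cancels against its inverse only near [f p], so the composite of the local
   expressions is the local expression of [g \o f] only near the centre. *)
have e : \forall x \near chart A p p,
    (in_charts B C g (f p) \o in_charts A B f p) x = in_charts A C (g \o f) p x.
  have := near_chart_inv rA (cf _ (regular_chartK rB)).
  by apply: filterS => x; rewrite /in_charts /= => ->.
have fp : in_charts A B f p (chart A p p) = chart B (f p) (f p).
  by rewrite /in_charts chart_inv_center.
have df := smooth_at_diff sf; have dg := smooth_at_diff sg.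
rewrite -fp in dg.
split; last first.
  move=> u; have [_ ] := near_eq_diff e (differentiable_comp df dg).
  by rewrite /mdiff => ->; rewrite diff_comp //= fp.
split; first exact: continuous_comp cf cg.
have nW : \forall x \near chart A p p, W (in_charts A B f p x).
  apply: (differentiable_continuous df); rewrite fp.
  exact: open_nbhs_nbhs.
have nV : \forall x \near chart A p p, V x by exact: open_nbhs_nbhs.
have : \forall x \near chart A p p, [/\ V x, W (in_charts A B f p x) &
    (in_charts B C g (f p) \o in_charts A B f p) x = in_charts A C (g \o f) p x].
  by near=> x; split; near: x.
move=> /near_open[Z [oZ Zp hZ]].
exists Z; split => // k.
apply: (@Ck_eq _ _ _ _ _ (in_charts B C g (f p) \o in_charts A B f p)) => //.
  by move=> x /hZ [].
apply: (Ck_comp (regular_frame rB) oZ) (kW k); first by move=> x /hZ [].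
by apply: Ck_sub (kV k) => x /hZ [].
Unshelve. all: by end_near. Qed.

End Comp3.

Definition is_smooth (E F : normedModType R) (M N : topologicalType)
    (A : charts E M) (B : charts F N) (f : M -> N) (p : M) (df : E -> F) :=
  smooth_at A B f p /\ forall u, mdiff A B f p u = df u.

Lemma smooth_at_is_smooth (E F : normedModType R) (M N : topologicalType)
    (A : charts E M) (B : charts F N) (f : M -> N) p :
  smooth_at A B f p -> is_smooth A B f p (mdiff A B f p).
Proof. by []. Qed.

Lemma is_smooth_near (E F : normedModType R) (M N : topologicalType)
    (A : charts E M) (B : charts F N) (f g : M -> N) p df :
  regular_chart A p -> (\forall q \near p, f q = g q) ->
  is_smooth A B f p df -> is_smooth A B g p df.
Proof.
move=> rA fg [sf hf]; have [sg e] := smooth_at_near rA fg sf.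
by split=> // u; rewrite e hf.
Qed.

Lemma is_smooth_comp (E F H : normedModType R) (M N P : topologicalType)
    (A : charts E M) (B : charts F N) (C : charts H P)
    (f : M -> N) (g : N -> P) p q df dg :
  regular_chart A p -> regular_chart B q -> f p = q ->
  is_smooth A B f p df -> is_smooth B C g q dg ->
  is_smooth A C (g \o f) p (dg \o df).
Proof.
move=> rA rB e; rewrite -{}e in rB * => -[sf hf] [sg hg].
have [s h] := smooth_at_comp rA rB sf sg.
by split=> // u; rewrite h hf hg.
Qed.

Lemma is_smooth_cst (E F : normedModType R) (M N : topologicalType)
    (A : charts E M) (B : charts F N) (a : N) p :
  is_smooth A B (fun=> a) p (fun=> 0).
Proof. by split=> [|u]; [exact: smooth_at_cst|exact: mdiff_cst]. Qed.

Lemma is_smooth_vec (E F : normedModType R) (f : E -> F) x :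
  (forall k, Ck k setT f) ->
  is_smooth (vec_charts E) (vec_charts F) f x ('d f x).
Proof.
move=> kf; split=> //; split; first exact: (kf 0%N).
by exists setT; split=> //; exact: openT.
Qed.

Lemma is_smooth_linear (E F : normedModType R) (f : E -> F) x :
  finite_frame E -> linear f -> is_smooth (vec_charts E) (vec_charts F) f x f.
Proof.
move=> fE lf; have cf := linear_frame_continuous fE lf.
have [s h] := is_smooth_vec x (fun k => Ck_linear k setT lf cf).
by split=> // u; rewrite h; have [_ ->] := linear_diff x lf cf.
Qed.

Lemma is_smooth_translate (E : normedModType R) (a x : E) :
  finite_frame E -> is_smooth (vec_charts E) (vec_charts E) (fun y => y + a) x id.
Proof.
move=> fE; have kf k : Ck k setT (fun y : E => y + a).
  apply: CkD; [exact: openT| |exact: Ck_cst].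
  by apply: Ck_linear => // y; exact: cvg_id.
have [s h] := is_smooth_vec x kf; split=> // u; rewrite h.
have di : differentiable (id : E -> E) x by apply: ex_diff.
rewrite (_ : (fun y => y + a) = id + cst a) // (diffD di (differentiable_cst a x)).
by rewrite diff_cst /= diff_val addr0.
Qed.

Section Prod.
Variables (E F H : normedModType R) (M N P : topologicalType).
Variables (A : charts E M) (B : charts F N) (C : charts H P).

Lemma prod_regular p q : regular_chart B p -> regular_chart C q ->
  regular_chart (prod_charts B C) (p, q).
Proof.
move=> [fB cB iB KB IB] [fC cC iC KC IC]; split.
- exact: prod_frame.
- exact: (cvg_pair (cvg_comp fst (chart B p) cvg_fst cB)
    (cvg_comp snd (chart C q) cvg_snd cC)).
- exact: (cvg_pair (cvg_comp fst (chart_inv B p) cvg_fst iB)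
    (cvg_comp snd (chart_inv C q) cvg_snd iC)).
- have h1 : \forall z \near ((p, q) : N * P), chart_inv B p (chart B p z.1) = z.1.
    exact: (@cvg_fst _ _ (nbhs p) (nbhs q) _ _ KB).
  have h2 : \forall z \near ((p, q) : N * P), chart_inv C q (chart C q z.2) = z.2.
    exact: (@cvg_snd _ _ (nbhs p) (nbhs q) _ _ KC).
  by near=> z; rewrite [RHS]surjective_pairing; congr pair; near: z.
- have h1 : \forall z \near ((chart B p p, chart C q q) : F * H),
      chart B p (chart_inv B p z.1) = z.1.
    exact: (@cvg_fst _ _ (nbhs (chart B p p)) (nbhs (chart C q q)) _ _ IB).
  have h2 : \forall z \near ((chart B p p, chart C q q) : F * H),
      chart C q (chart_inv C q z.2) = z.2.
    exact: (@cvg_snd _ _ (nbhs (chart B p p)) (nbhs (chart C q q)) _ _ IC).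
  by near=> z; rewrite [RHS]surjective_pairing; congr pair; near: z.
Unshelve. all: by end_near. Qed.

Lemma Ck_pair k (U : set E) (f : E -> F) (g : E -> H) : open U ->
  Ck k U f -> Ck k U g -> Ck k U (fun x => (f x, g x)).
Proof.
move=> oU; elim: k f g => [|k IH] f g /=.
  by move=> hf hg x Ux; apply: cvg_pair; [exact: hf|exact: hg].
move=> [f1 f2] [g1 g2]; split=> [x Ux|v].
  by apply: differentiable_pair; [exact: f1|exact: g1].
apply: (Ck_eq oU _ (IH _ _ (f2 v) (g2 v))) => x Ux.
by rewrite (diff_pair (f1 x Ux) (g1 x Ux)).
Qed.

Lemma is_smooth_pair (f : M -> N) (g : M -> P) p df dg :
  is_smooth A B f p df -> is_smooth A C g p dg ->
  is_smooth A (prod_charts B C) (fun x => (f x, g x)) p (fun u => (df u, dg u)).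
Proof.
move=> [sf hf] [sg hg].
have [cf [V [oV Vp kV]]] := sf; have [cg [W [oW Wp kW]]] := sg.
split; last first.
  move=> u; rewrite -hf -hg /mdiff.
  have := diff_pair (smooth_at_diff sf) (smooth_at_diff sg).
  by move=> /(congr1 (@^~ u)).
split; first exact: cvg_pair.
exists (V `&` W); split=> // [|k]; first exact: openI.
apply: (@Ck_pair _ _ (in_charts A B f p) (in_charts A C g p)); first exact: openI.
  by apply: Ck_sub (kV k) => x [].
by apply: Ck_sub (kW k) => x [].
Qed.

End Prod.

Section Pow.
Variables (d m : nat) (N : topologicalType) (B : charts 'rV[R]_d N).

Lemma ptws_continuous (M : topologicalType) (f : M -> {ptws 'I_m -> N}) p :
  (forall i, continuous_at p (fun x => f x i)) -> continuous_at p f.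
Proof.
move=> h; apply/cvg_sup => i U [V] [[W] oW <-] WfN WU.
apply: (filterS WU); apply: (h i); exact: open_nbhs_nbhs.
Qed.

Lemma rows_continuous (M : topologicalType) (f : 'I_m -> M -> 'rV[R]_d) p :
  (forall i, continuous_at p (f i)) ->
  continuous_at p (fun x => \matrix_(i < m) f i x).
Proof.
move=> h; apply/cvg_ballP => e e0.
have hi i : \forall x \near p, ball (f i p) e (f i x).
  by move: (h i) => /cvg_ballP; exact.
have hh := near_forall hi.
near=> x; have hx : forall i, ball (f i p) e (f i x) by near: x.
split=> // i j.
by have [_ /(_ 0 j)] := hx i; rewrite !mxE.
Unshelve. all: by end_near. Qed.

Lemma linear_row (i : 'I_m) : linear (row i : 'M[R]_(m, d) -> 'rV[R]_d).
Proof. by move=> a x y; rewrite linearP. Qed.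

Lemma row_cts (i : 'I_m) : continuous (row i : 'M[R]_(m, d) -> 'rV[R]_d).
Proof. by apply: linear_frame_continuous (@linear_row i); exact: mx_frame. Qed.

(** A matrix is the sum of the images of its rows under the linear maps [v |-> delta_mx i 0 *m v],
    so sums and linear maps suffice. *)
Lemma Ck_rows (E : normedModType R) k (U : set E) (f : 'I_m -> E -> 'rV[R]_d) :
  open U -> (forall i, Ck k U (f i)) -> Ck k U (fun x => \matrix_(i < m) f i x).
Proof.
move=> oU h.
have e x : \matrix_(i < m) f i x = \sum_(i < m) (delta_mx i 0 : 'cV_m) *m f i x.
  apply/matrixP => a b; rewrite mxE summxE (bigD1 a) //= big1 => [|i ia].
    by rewrite addr0 !mxE big_ord1 !mxE !eqxx mul1r.
  by rewrite !mxE big_ord1 !mxE eq_sym (negbTE ia) mul0r.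
rewrite (_ : (fun x => _) = fun x => \sum_(i < m) (delta_mx i 0 : 'cV_m) *m f i x);
  last exact/funext.
apply: Ck_sum => // i.
have ll : linear (fun v : 'rV[R]_d => (delta_mx i 0 : 'cV[R]_m) *m v).
  by move=> a x y; rewrite linearP.
apply: (@Ck_comp _ _ _ _ _ _ setT (f i) _ (mx_frame _ 1 d)) => //.
by apply: Ck_linear => //; apply: linear_frame_continuous => //; exact: mx_frame.
Qed.

Lemma proj_near (p : {ptws 'I_m -> N}) i (P : set N) :
  (\forall q \near p i, P q) -> \forall q \near p, P (q i).
Proof. exact: (@proj_continuous _ (fun=> N) i p). Qed.

Lemma near_row (x : 'M[R]_(m, d)) i (P : set 'rV[R]_d) :
  (\forall y \near row i x, P y) -> \forall y \near x, P (row i y).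
Proof. exact: (@row_cts i x). Qed.

Lemma pow_regular (p : {ptws 'I_m -> N}) :
  (forall i, regular_chart B (p i)) -> regular_chart (pow_charts B m) p.
Proof.
move=> rB; split.
- exact: mx_frame.
- apply: rows_continuous => i.
  apply: (@continuous_comp _ _ _ (fun q : {ptws 'I_m -> N} => q i)).
    exact: (@proj_continuous _ (fun=> N) i p).
  exact: regular_continuous.
- apply: ptws_continuous => i.
  apply: (@continuous_comp _ _ _ (row i) (chart_inv B (p i))).
    exact: row_cts.
  by rewrite rowK; exact: regular_inv_continuous.
- have h i : \forall q \near p, chart_inv B (p i) (chart B (p i) (q i)) = q i.
    exact: (proj_near (regular_chartK (rB i))).
  apply: filterS (near_forall h) => q hq; apply/funext => i /=.
  by rewrite rowK hq.
- have h i : \forall x \near chart (pow_charts B m) p p,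
      chart B (p i) (chart_inv B (p i) (row i x)) = row i x.
    apply: (near_row (P := fun y => chart B (p i) (chart_inv B (p i) y) = y)).
    by rewrite rowK; exact: regular_invK.
  apply: filterS (near_forall h) => x hx; apply/row_matrixP => i /=.
  by rewrite rowK hx.
Qed.

Lemma is_smooth_proj (p : {ptws 'I_m -> N}) i :
  (forall i, regular_chart B (p i)) ->
  is_smooth (pow_charts B m) B (fun q : {ptws 'I_m -> N} => q i) p (row i).
Proof.
move=> rB; have h : \forall x \near chart (pow_charts B m) p p,
    row i x = in_charts (pow_charts B m) B (fun q : {ptws 'I_m -> N} => q i) p x.
  apply: (near_row (P := fun y => y = chart B (p i) (chart_inv B (p i) y))).
  by rewrite rowK; apply: filterS (regular_invK (rB i)) => x.
have [dr er] := linear_diff (chart (pow_charts B m) p p) (@linear_row i) (@row_cts i).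
split; last by move=> u; rewrite /mdiff; have [_ ->] := near_eq_diff h dr; rewrite er.
split; first exact: (@proj_continuous _ (fun=> N) i p).
have [W [oW Wp We]] := near_open h.
by exists W; split => // k; apply: (Ck_eq oW We); apply: Ck_linear;
  [exact: linear_row|exact: row_cts].
Qed.

Lemma is_smooth_ptws (E : normedModType R) (M : topologicalType) (A : charts E M)
    (f : M -> {ptws 'I_m -> N}) p (df : 'I_m -> E -> 'rV[R]_d) :
  (forall i, is_smooth A B (fun x => f x i) p (df i)) ->
  is_smooth A (pow_charts B m) f p (fun u => \matrix_i df i u).
Proof.
move=> h.
(* Each component is smooth on a domain of its own; there are finitely many, so the chosen domains
   share a neighbourhood of the centre. *)
pose V := fun i => xget setT [set V : set E | [/\ open V, V (chart A p p) &
    forall k, Ck k V (in_charts A B (fun x => f x i) p)]].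
have hV i : [/\ open (V i), V i (chart A p p) &
    forall k, Ck k (V i) (in_charts A B (fun x => f x i) p)].
  by have [[_ [W hW]] _] := h i; rewrite /V; case: xgetP => [W' -> //|/(_ W)].
have nV : \forall x \near chart A p p, forall i, V i x.
  by apply: near_forall => i; have [oV Vp _] := hV i; exact: open_nbhs_nbhs.
have [U [oU Up UV]] := near_open nV.
have kU k : Ck k U (in_charts A (pow_charts B m) f p).
  apply: Ck_rows => // i; have [_ _ kV] := hV i.
  by apply: Ck_sub (kV k) => x /UV.
have cf : continuous_at p f.
  by apply: ptws_continuous => i; have [[]] := h i.
have sf : smooth_at A (pow_charts B m) f p by split=> //; exists U.
split=> // u; apply/row_matrixP => i; rewrite rowK.
have [_ <-] := h i; rewrite /mdiff.
have [dr er] := linear_diff (in_charts A (pow_charts B m) f p (chart A p p))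
  (@linear_row i) (@row_cts i).
have := diff_comp (smooth_at_diff sf) dr; rewrite er => /(congr1 (@^~ u)) /= <-.
congr ('d _ _ u); apply/funext => x /=.
by rewrite rowK.
Qed.
End Pow.
End ChartCalculus.

(** * Images under diffeomorphisms *)

Section Transport.
Variables (R : realType) (E : normedModType R) (N : topologicalType).
Variables (A : charts E N).
Hypothesis rA : forall p, regular_chart A p.

Lemma tangent_map (F : N -> N) (S T : set N) p u :
  smooth_on A A setT F -> F @` S `<=` T -> tangent A S p u ->
  tangent A T (F p) (mdiff A A F p u).
Proof.
move=> sF FST [e [c [e0 sc c0 cS ->]]].
have rR t : regular_chart (vec_charts R^o) t by apply: vec_regular; exact: Ro_frame.
have sFc t : `|t| < e -> smooth_at (vec_charts R^o) A (F \o c) t /\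
  forall u, mdiff (vec_charts R^o) A (F \o c) t u =
    mdiff A A F (c t) (mdiff (vec_charts R^o) A c t u).
  by move=> te; apply: smooth_at_comp => //; [exact: sc|exact: sF].
exists e, (F \o c); split => //.
- by move=> t /sFc [].
- by rewrite /= c0.
- by move=> t te; apply: FST; exists (c t) => //; exact: cS.
- by have [|_ ->] := sFc 0; rewrite ?normr0 // c0.
Qed.

Section Diffeo.
Variables F F' : N -> N.
Hypotheses (FK : cancel F F') (F'K : cancel F' F).
Hypotheses (sF : smooth_on A A setT F) (sF' : smooth_on A A setT F').

Lemma mdiff_cancel p u : mdiff A A F' (F p) (mdiff A A F p u) = u.
Proof.
have [_ <-] := smooth_at_comp (rA p) (rA (F p)) (sF (p := p) I) (sF' (p := F p) I).
have [_ h] := smooth_at_id (rA p).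
by rewrite (_ : F' \o F = id) ?h //; apply/funext => q /=.
Qed.

Lemma local_param_image (S : set N) k (V : set 'rV[R]_k) phi :
  local_param A S V phi -> local_param A (F @` S) V (F \o phi).
Proof.
move=> [oV sphi ijd ij im].
have rV x : regular_chart (vec_charts 'rV[R]_k) x by apply: vec_regular; exact: mx_frame.
have sFphi x : V x -> smooth_at (vec_charts 'rV[R]_k) A (F \o phi) x /\
  forall u, mdiff (vec_charts 'rV[R]_k) A (F \o phi) x u =
    mdiff A A F (phi x) (mdiff (vec_charts 'rV[R]_k) A phi x u).
  by move=> Vx; apply: smooth_at_comp => //; [exact: sphi|exact: sF].
split => //.
- by move=> x /sFphi [].
- move=> x Vx u v; have [_ h] := sFphi x Vx; rewrite !h => e.
  by apply: (ijd x Vx); rewrite -[LHS](mdiff_cancel (phi x)) e mdiff_cancel.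
- by move=> x y Vx Vy /(can_inj FK); exact: ij.
- move=> V' oV' V'V; have [W oW eW] := im V' oV' V'V.
  exists (F' @^-1` W).
    by apply: open_comp => // p _; have [] := sF' (p := p) I.
  rewrite -image_comp eW; apply/seteqP; split=> [_ [p [Sp Wp] <-]|_ [[p Sp <-]] /=].
    by split; [exists p|rewrite /= FK].
  by rewrite FK => Wp; exists p.
Qed.

Lemma submanifold_image S : submanifold A S -> submanifold A (F @` S).
Proof.
move=> [k hk]; exists k => _ [p Sp <-].
have [V [phi [lp [x Vx ex]]]] := hk p Sp.
exists V, (F \o phi); split; first exact: local_param_image.
by exists x => //=; rewrite ex.
Qed.

(** Invariance of [w] is asked for only at points of [L] and on vectors tangent to [S]. This is what
    can be checked for omega_C, whose value is known in closed form where the total product is 1. *)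
Lemma lagrangian_image S w L :
  F @` S = S ->
  (forall p u v, L p -> tangent A S p u -> tangent A S p v ->
    w (F p) (mdiff A A F p u) (mdiff A A F p v) = w p u v) ->
  lagrangian_submanifold A S w L -> lagrangian_submanifold A S w (F @` L).
Proof.
move=> FS wF [LS sL tL].
have tSF p u : tangent A S p u -> tangent A S (F p) (mdiff A A F p u).
  by apply: tangent_map => //; rewrite FS.
have F'S : F' @` S = S.
  by rewrite -{1}FS image_comp (_ : F' \o F = id) ?image_id //; apply/funext => q /=.
have tSF' p u : tangent A S (F p) u -> tangent A S p (mdiff A A F' (F p) u).
  move=> h; rewrite -{1}(FK p); apply: tangent_map h => //; by rewrite F'S.
have tLF p u : tangent A L p u -> tangent A (F @` L) (F p) (mdiff A A F p u).
  exact: tangent_map.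
have tLF' p u : tangent A (F @` L) (F p) u -> tangent A L p (mdiff A A F' (F p) u).
  move=> h; rewrite -{1}(FK p); apply: tangent_map h => //.
  by rewrite image_comp (_ : F' \o F = id) ?image_id //; apply/funext => q /=.
have dK p u : mdiff A A F p (mdiff A A F' (F p) u) = u.
  have [_ h] := smooth_at_comp (rA (F p)) (rA (F' (F p))) (sF' (p := F p) I)
    (sF (p := F' (F p)) I).
  rewrite -{1}(FK p) -h (_ : F \o F' = id); last by apply/funext => q /=.
  by have [_ ->] := smooth_at_id (rA (F p)).
split; first by rewrite -FS; exact: image_subset.
  exact: submanifold_image.
move=> _ [p Lp <-]; apply/seteqP; split=> [u tu|u [tu wu]].
  have := tLF' _ _ tu; rewrite {1}tL //= => -[tu' wu']; split.
    by rewrite -(dK p u); exact: tSF.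
  move=> v tv; have tv' := tLF' _ _ tv.
  rewrite -(dK p u) -(dK p v) wF //; first exact: wu'.
  by move: tv'; rewrite {1}tL //= => -[].
rewrite -(dK p u); apply: (tLF); rewrite tL //=; split; first exact: tSF'.
move=> v tv; rewrite -wF //; last by move: tv; rewrite {1}tL //= => -[].
- by rewrite dK; apply: wu; exact: tLF.
- exact: tSF'.
Qed.

End Diffeo.
End Transport.

(** * The tangent group of a Lie group *)

Section LieCalculus.
Variables (R : realType) (d : nat) (G : lieGroupType R d).

Local Notation AG := (@lie_charts R d G).
Implicit Types (g h : G) (a b X Y : 'rV[R]_d).

Lemma lie_regular g : regular_chart AG g.
Proof. by apply: smooth_manifold_regular; [exact: mx_frame|exact: lie_manifold]. Qed.
Local Hint Resolve lie_regular : core.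

Lemma prod_lie_regular (p : G * G) : regular_chart (prod_charts AG AG) p.
Proof. by case: p => g h; exact: prod_regular. Qed.

Section Products.
Variables (E : normedModType R) (M : topologicalType) (A : charts E M) (p : M).
Hypothesis rA : regular_chart A p.

Lemma smooth_at_mul (f g : M -> G) : smooth_at A AG f p -> smooth_at A AG g p ->
  smooth_at A AG (fun x => (f x * g x)%g) p.
Proof.
move=> sf sg; have sfg := is_smooth_pair (smooth_at_is_smooth sf) (smooth_at_is_smooth sg).
have sm := smooth_at_is_smooth (@lie_mul_smooth R d G (f p, g p) I).
by have [] := is_smooth_comp rA (prod_lie_regular _) (erefl _) sfg sm.
Qed.

Lemma smooth_at_inv (f : M -> G) : smooth_at A AG f p ->
  smooth_at A AG (fun x => (f x)^-1%g) p.
Proof.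
move=> sf; have [] := smooth_at_comp rA (lie_regular (f p)) sf
  (@lie_inv_smooth R d G (f p) I); by [].
Qed.

End Products.

Definition smooth_map (f : G -> G) := forall g, smooth_at AG AG f g.

Lemma smooth_map_id : smooth_map id.
Proof. by move=> g; have [] := smooth_at_id (lie_regular g). Qed.

Lemma smooth_map_cst h : smooth_map (fun=> h).
Proof. by move=> g; exact: smooth_at_cst. Qed.

Lemma smooth_mulr h : smooth_map (fun x => x * h)%g.
Proof. by move=> g; apply: smooth_at_mul => //; [exact: smooth_map_id|exact: smooth_map_cst]. Qed.

Lemma smooth_mull h : smooth_map (fun x => h * x)%g.
Proof. by move=> g; apply: smooth_at_mul => //; [exact: smooth_map_cst|exact: smooth_map_id]. Qed.

Lemma smooth_conj h : smooth_map (fun x => h * x * h^-1)%g.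
Proof. by move=> g; apply: smooth_at_mul => //; [exact: smooth_mull|exact: smooth_map_cst]. Qed.

Lemma mdiff_smooth_comp (f f' : G -> G) g h u :
  smooth_map f -> smooth_map f' -> f g = h ->
  mdiff AG AG f' h (mdiff AG AG f g u) = mdiff AG AG (f' \o f) g u.
Proof.
move=> sf sf' <-.
by have [] := smooth_at_comp (lie_regular g) (lie_regular (f g)) (sf g) (sf' (f g)).
Qed.

Lemma mdiff_ext (E : normedModType R) (M : Type) (A : charts E M) (f f' : M -> G) p (u : E) :
  f =1 f' -> mdiff A AG f p u = mdiff A AG f' p u.
Proof. by move=> /funext ->. Qed.

Lemma mdiff_idG g u : mdiff AG AG id g u = u.
Proof. by have [_ ->] := smooth_at_id (lie_regular g). Qed.

Lemma mc_rightK g u : right_translate (mc_right g u) g = u.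
Proof.
rewrite /right_translate /mc_right.
rewrite (mdiff_smooth_comp u (smooth_mulr g^-1%g) (smooth_mulr g) (mulgV g)).
by rewrite (_ : _ \o _ = id) ?mdiff_idG //; apply/funext => x /=; rewrite mulgVK.
Qed.

Lemma right_translateK g X : mc_right g (right_translate X g) = X.
Proof.
rewrite /right_translate /mc_right.
rewrite (mdiff_smooth_comp X (smooth_mulr g) (smooth_mulr g^-1%g) (mul1g g)).
by rewrite (_ : _ \o _ = id) ?mdiff_idG //; apply/funext => x /=; rewrite mulgK.
Qed.

Lemma AdM g h X : Ad (g * h)%g X = Ad g (Ad h X).
Proof.
have e : (h * 1 * h^-1)%g = 1%g by rewrite mulg1 mulgV.
rewrite /Ad (mdiff_smooth_comp X (smooth_conj h) (smooth_conj g) e).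
by apply: mdiff_ext => x /=; rewrite invgM !mulgA.
Qed.

Lemma Ad1 X : Ad (1 : G)%g X = X.
Proof.
rewrite /Ad (_ : (fun h : G => _) = id) ?mdiff_idG //.
by apply/funext => x; rewrite invg1 mulg1 mul1g.
Qed.

Lemma linear_Ad g : linear (Ad g).
Proof. by move=> c X Y; rewrite /Ad /mdiff linearP. Qed.
HB.instance Definition _ g := GRing.isLinear.Build _ _ _ _ (Ad g) (linear_Ad g).

Lemma AdN g X : Ad g (- X) = - Ad g X.
Proof. exact: (linearN (Ad g)). Qed.

Lemma AdZ g (s : R) X : Ad g (s *: X) = s *: Ad g X.
Proof. by have := linear_Ad g s X 0; rewrite !addr0 (linear0 (Ad g)) addr0. Qed.

Lemma AdK g X : Ad g^-1%g (Ad g X) = X.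
Proof. by rewrite -AdM mulVg Ad1. Qed.

Lemma mc_left_Ad g u : mc_left g u = Ad g^-1%g (mc_right g u).
Proof.
rewrite /Ad /mc_right /mc_left.
rewrite (mdiff_smooth_comp u (smooth_mulr g^-1%g) (smooth_conj g^-1%g) (mulgV g)).
by apply: mdiff_ext => x /=; rewrite invgK !mulgA mulgVK.
Qed.

Lemma mc_right0 g : mc_right g 0 = 0.
Proof. by rewrite /mc_right /mdiff linear0. Qed.

Lemma mc_rightD g u v : mc_right g (u + v) = mc_right g u + mc_right g v.
Proof. by rewrite /mc_right /mdiff linearD. Qed.

(* [(g, X)] stands for the tangent vector [X.g] at [g]; the product is the group
   structure of the tangent bundle *)
Definition tangent_group : Type := (G * 'rV[R]_d)%type.
HB.instance Definition _ := Choice.on tangent_group.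


Definition tmul (x y : tangent_group) : tangent_group := ((x.1 * y.1)%g, x.2 + Ad x.1 y.2).
Definition tone : tangent_group := (1%g, 0).
Definition tinv (x : tangent_group) : tangent_group := ((x.1)^-1%g, - Ad (x.1)^-1%g x.2).

Lemma tmulA : associative tmul.
Proof. by move=> x y z; rewrite /tmul /= mulgA AdM linearD addrA. Qed.
Lemma tmul1 : left_id tone tmul.
Proof. by case=> g a; rewrite /tmul /= mul1g Ad1 add0r. Qed.
Lemma tmul1r : right_id tone tmul.
Proof. by case=> g a; rewrite /tmul /= mulg1 linear0 addr0. Qed.
Lemma tmulV : left_inverse tone tinv tmul.
Proof. by case=> g a; rewrite /tmul /= mulVg addNr. Qed.
Lemma tmulVr : right_inverse tone tinv tmul.
Proof. by case=> g a; rewrite /tmul /= mulgV linearN /= -AdM mulgV Ad1 subrr. Qed.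

HB.instance Definition _ := isGroup.Build tangent_group tmulA tmul1 tmul1r tmulV tmulVr.

Lemma tmulE (x y : tangent_group) : (x * y)%g = ((x.1 * y.1)%g, x.2 + Ad x.1 y.2) :> tangent_group.
Proof. by []. Qed.

Lemma tinvE (x : tangent_group) : (x^-1)%g = ((x.1)^-1%g, - Ad (x.1)^-1%g x.2) :> tangent_group.
Proof. by []. Qed.

Definition tlift g u : tangent_group := (g, mc_right g u).

Lemma tlift_inj g : injective (tlift g).
Proof. by move=> u v [e]; rewrite -(mc_rightK g u) e mc_rightK. Qed.

Section Lift.
Variables (E : normedModType R) (M : topologicalType) (A : charts E M) (p : M).
Hypothesis rA : regular_chart A p.

Definition tmap (f : M -> G) (u : E) : tangent_group :=
  tlift (f p) (mdiff A AG f p u).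

Lemma tmap_cst g u : tmap (fun=> g) u = (g, 0).
Proof. by rewrite /tmap mdiff_cst /tlift mc_right0. Qed.

Lemma tmap1 u : tmap (fun=> 1%g) u = 1%g.
Proof. exact: tmap_cst. Qed.

Lemma mdiff_mul (f g : M -> G) u : smooth_at A AG f p -> smooth_at A AG g p ->
  mdiff A AG (fun x => f x * g x)%g p u =
    mdiff AG AG (fun x => x * g p)%g (f p) (mdiff A AG f p u) +
    mdiff AG AG (fun x => f p * x)%g (g p) (mdiff A AG g p u).
Proof.
move=> sf sg; have sfg := is_smooth_pair (smooth_at_is_smooth sf) (smooth_at_is_smooth sg).
have sm := smooth_at_is_smooth (@lie_mul_smooth R d G (f p, g p) I).
have [_ ->] := is_smooth_comp rA (prod_lie_regular _) (erefl _) sfg sm.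
rewrite /=; set v := mdiff A AG f p u; set w := mdiff A AG g p u.
(* The differential of multiplication at [(v, w)] is the sum of its values at [(v, 0)] and [(0, w)],
   which are the differentials of the two translations. *)
have idf := smooth_at_is_smooth (smooth_map_id (f p)).
have idg := smooth_at_is_smooth (smooth_map_id (g p)).
have cf := @is_smooth_cst _ _ _ _ _ AG AG (g p) (f p).
have cg := @is_smooth_cst _ _ _ _ _ AG AG (f p) (g p).
have [_ /(_ v)] := is_smooth_comp (lie_regular _) (prod_lie_regular _) (erefl _)
  (is_smooth_pair idf cf) sm.
have [_ /(_ w)] := is_smooth_comp (lie_regular _) (prod_lie_regular _) (erefl _)
  (is_smooth_pair cg idg) sm.
rewrite /= !mdiff_idG => hw hv.
transitivity (mdiff AG AG (fun x : G => (x * g p)%g) (f p) v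
  + mdiff AG AG (fun x : G => (f p * x)%g) (g p) w) => //.
rewrite hv hw -linearD; congr ('d _ _ _).
by congr pair; rewrite /= ?addr0 ?add0r.
Qed.

Lemma tmapM (f g : M -> G) u : smooth_at A AG f p -> smooth_at A AG g p ->
  tmap (fun x => f x * g x)%g u = (tmap f u * tmap g u)%g.
Proof.
move=> sf sg; rewrite /tmap /tlift tmulE /=; apply: (congr1 (pair _)).
rewrite (mdiff_mul u sf sg) mc_rightD; apply: f_equal2.
  rewrite /mc_right (mdiff_smooth_comp _ (smooth_mulr (g p)) (smooth_mulr _) (erefl _)).
  apply: mdiff_ext => x /=.
  by rewrite invgM mulgA mulgK.
rewrite /mc_right (mdiff_smooth_comp _ (smooth_mull (f p)) (smooth_mulr _) (erefl _)).
rewrite /Ad (mdiff_smooth_comp _ (smooth_mulr (g p)^-1%g) (smooth_conj (f p)) (mulgV _)).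
by apply: mdiff_ext => x /=; rewrite invgM !mulgA.
Qed.

Lemma tmapV (f : M -> G) u : smooth_at A AG f p ->
  tmap (fun x => (f x)^-1)%g u = (tmap f u)^-1%g.
Proof.
move=> sf; apply: (@mulgI _ (tmap f u)); rewrite mulgV -tmapM //; last exact: smooth_at_inv.
rewrite (_ : (fun x => _) = (fun=> 1%g)) ?tmap1 //.
by apply/funext => x; rewrite mulgV.
Qed.

Lemma tmap_near (f g : M -> G) u : (\forall x \near p, f x = g x) ->
  smooth_at A AG f p -> tmap f u = tmap g u.
Proof.
move=> fg sf; rewrite /tmap; have [_ ->] := smooth_at_near rA fg sf.
by rewrite (nbhs_singleton fg).
Qed.

End Lift.
End LieCalculus.

(** * One-parameter subgroups *)

Section Exponential.
Variables (R : realType) (d : nat) (G : lieGroupType R d).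

Local Notation AG := (@lie_charts R d G).
Local Notation AR := (vec_charts R^o).
Implicit Types (g h : G) (X Y : 'rV[R]_d).

Local Hint Resolve lie_regular : core.

Lemma real_regular (t : R^o) : regular_chart AR t.
Proof. by apply: vec_regular; exact: Ro_frame. Qed.
Local Hint Resolve real_regular : core.

(** Read in the chart at [q], this map is a transition map of the atlas. It allows a curve to be
    followed in one fixed chart although its velocity at each time is expressed in the chart of the
    current point. *)
Lemma smooth_at_chart p q : chart_dom AG p q ->
  smooth_at AG (vec_charts 'rV[R]_d) (chart AG p) q.
Proof.
move=> pq; have mG := @lie_manifold R d G.
split; first exact: (chart_continuous mG pq).
have qq := chart_center mG q.
have h : \forall g \near q, chart_dom AG p g /\ chart_dom AG q g.
  near=> g; split; near: g; apply: open_nbhs_nbhs; split => //;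
  exact: (chart_dom_open mG).
have [W [oW Wq hW]] := near_open (near_chart_inv (lie_regular q) h).
have [W' [oW' Wq' hW']] := near_open (regular_invK (lie_regular q)).
exists (W `&` W'); split=> // [|k]; first exact: openI.
apply: Ck_sub (chart_compatible mG q p k) => x [Wx W'x].
exists (chart_inv AG q x); first by have [] := hW x Wx.
exact: hW'.
Unshelve. all: by end_near. Qed.

Lemma constant_coordinate (f : R -> R) (e : R) :
  (forall t : R, `|t| < e -> differentiable f t /\ 'd f t 1 = 0) ->
  forall t : R, `|t| < e -> f t = f 0.
Proof.
move=> h t te.
have he s : Order.min 0 t <= s <= Order.max 0 t -> `|s| < e.
  move=> /andP[s1 s2]; apply: le_lt_trans te; rewrite ler_norml.
  move: s1 s2; rewrite ge_min le_max => /orP[s1|s1] /orP[s2|s2].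
  - by rewrite (_ : s = 0) ?oppr_le0 ?normr_ge0 //; apply/eqP; rewrite eq_le s1 s2.
  - by rewrite (le_trans s2 (ler_norm t)) andbT (le_trans _ s1) // oppr_le0.
  - rewrite (le_trans s2) // andbT (le_trans _ s1) // lerNl.
    by rewrite -normrN ler_norm.
  - by rewrite (le_trans s2 (ler_norm t)) andbT (le_trans _ s1) // lerNl -normrN ler_norm.
have m01 : Order.min 0 t <= Order.max 0 t by rewrite ge_min !le_max lexx.
have [||c _] := @MVT_segment _ f (fun=> 0) _ _ m01.
- move=> s; rewrite in_itv /= => /andP[s1 s2].
  have hs : Order.min 0 t <= s <= Order.max 0 t by rewrite !ltW.
  have [ds es] := h s (he s hs).
  by apply: DeriveDef; [exact: diff_derivable|rewrite deriveE].
- apply: continuous_in_subspaceT => s; rewrite inE /= in_itv /= => hs.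
  by apply: differentiable_continuous; have [] := h s (he s hs).
rewrite mul0r => /eqP; rewrite subr_eq0.
by case: (lerP 0 t) => [t0|/ltW t0] /eqP ->.
Qed.

Lemma locally_constant (c : R^o -> G) :
  smooth_on AR AG setT c -> (forall t, mdiff AR AG c t 1 = 0) ->
  exists2 e : R, 0 < e & forall t : R, `|t| < e -> c t = c 0.
Proof.
move=> sc dc; have mG := @lie_manifold R d G.
have [cc _] := sc 0 I.
have : \forall t \near (0 : R^o), chart_dom AG (c 0) (c t).
  by apply: cc; apply: open_nbhs_nbhs; split; [exact: (chart_dom_open mG)|exact: (chart_center mG)].
move=> /nbhs_ballP[e /= e0 he]; exists e => // t te.
have ce (s : R) : `|s| < e -> chart_dom AG (c 0) (c s).
  by move=> se; apply: he; rewrite /ball /= sub0r normrN.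
have dpsi (s : R^o) : `|s| < e ->
    differentiable (chart AG (c 0) \o c : R^o -> 'rV[R]_d) s /\
    'd (chart AG (c 0) \o c : R^o -> 'rV[R]_d) s 1 = 0.
  move=> se; have [sp hp] := smooth_at_comp (real_regular s) (lie_regular _)
    (sc s I) (smooth_at_chart (ce s se)).
  split; first exact: (smooth_at_diff sp).
  by have := hp 1; rewrite dc /mdiff linear0.
suff E : chart AG (c 0) (c t) = chart AG (c 0) (c 0).
  by rewrite -(chartK mG (ce t te)) E (chartK mG (chart_center mG (c 0))).
apply/rowP => j.
apply: (@constant_coordinate (fun s : R => chart AG (c 0) (c s) 0 j) e) => // s se.
have [ds es] := dpsi s se.
have dj := @differentiable_coord R 1 d (chart AG (c 0) (c s)) 0 j.
have lj : linear (fun x : 'rV[R]_d => x 0 j : R^o) by move=> a x y; rewrite !mxE.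
have [_ ej] := linear_diff (chart AG (c 0) (c s)) lj (@coord_continuous _ _ _ 0 j).
split; first exact: (differentiable_comp ds dj).
have := diff_comp ds dj => /(congr1 (@^~ 1)) /= ->.
by rewrite es linear0.
Qed.

Section OneParam.
Variables (c : R^o -> G) (X : 'rV[R]_d).
Hypothesis cX : one_param_subgroup c X.

Lemma ops0 : c 0 = 1%g.
Proof.
have [_ cD _] := cX; apply: (@mulgI _ (c 0)); rewrite mulg1 -cD.
by rewrite addr0.
Qed.

Lemma opsN (t : R) : c (- t) = (c t)^-1%g.
Proof.
have [_ cD _] := cX; apply: (@mulgI _ (c t)).
by rewrite mulgV -cD subrr ops0.
Qed.

Lemma opsMn (t : R) n : c (n%:R * t) = (c t ^+ n)%g.
Proof.
have [_ cD _] := cX; elim: n => [|n IH]; first by rewrite mul0r ops0.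
by rewrite -natr1 mulrDl mul1r cD IH expgSr.
Qed.

Lemma mc_right1 Y : mc_right (1 : G)%g Y = Y.
Proof.
rewrite /mc_right (_ : (fun h : G => _) = id) ?mdiff_idG //.
by apply/funext => x; rewrite invg1 mulg1.
Qed.

Lemma tmap_ops t : tmap AR t c 1 = (c t, X).
Proof.
have [sc cD dc] := cX.
have tr := is_smooth_translate (- t : R^o) t (Ro_frame R).
have sc0 := smooth_at_is_smooth (sc 0 I).
have [s1 h1] := is_smooth_comp (real_regular t) (real_regular 0) (subrr t) tr sc0.
(* Splitting off [c t] moves the derivative at [t] to the one at 0; right translation leaves the
   second component [X] unchanged. *)
have -> : c = (fun s => (c \o (fun y => y - t)) s * c t)%g :> (R^o -> G).
  by apply/funext => s /=; rewrite -cD subrK.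
rewrite tmapM //; last exact: smooth_at_cst.
rewrite tmap_cst /tmap /tlift h1 /= subrr ops0 dc mc_right1 tmulE /=.
by rewrite Ad1 addr0 mul1g.
Qed.

Lemma ops_scale (a : R) : one_param_subgroup (fun t => c (a * t)) (a *: X).
Proof.
have [sc cD dc] := cX.
have la : linear (fun t : R^o => a * t : R^o).
  by move=> b x y; rewrite mulrDr; congr (_ + _); exact: mulrCA.
have h t : is_smooth AR AG (fun t => c (a * t)) t (fun u => mdiff AR AG c (a * t) (a * u)).
  exact: (is_smooth_comp (real_regular t) (real_regular _) (erefl _)
    (is_smooth_linear t (Ro_frame R) la) (smooth_at_is_smooth (sc (a * t) I))).
split.
- by move=> t _; have [] := h t.
- by move=> s t; rewrite mulrDr cD.
- have [_ ->] := h 0; rewrite mulr0 -dc.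
  by rewrite -[a * 1]/(a *: (1 : R^o)) /mdiff linearZ.
Qed.

Lemma ops_conj g : one_param_subgroup (fun t => g * c t * g^-1)%g (Ad g X).
Proof.
have [sc cD dc] := cX.
have h t := smooth_at_comp (real_regular t) (lie_regular _) (sc t I) (smooth_conj g (c t)).
split.
- by move=> t _; have [] := h t.
- by move=> s t; rewrite cD !mulgA mulgVK.
- by have [_ ->] := h 0; rewrite ops0 dc.
Qed.

End OneParam.

(* [(c2 t)^-1 * c1 t] has zero derivative, hence is constant near 0; the relation
   [c t = (c (t / n)) ^+ n] then gives the equality everywhere. *)
Lemma ops_uniq (c1 c2 : R^o -> G) X :
  one_param_subgroup c1 X -> one_param_subgroup c2 X -> c1 = c2.
Proof.
move=> o1 o2; have [s1 D1 d1] := o1; have [s2 D2 d2] := o2.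
pose c (t : R^o) := ((c2 t)^-1 * c1 t)%g.
have sV t : smooth_at AR AG (fun t => (c2 t)^-1%g) t by apply: smooth_at_inv => //; exact: s2.
have sc : smooth_on AR AG setT c.
  by move=> t _; apply: smooth_at_mul => //; exact: s1.
have [|e e0 he] := locally_constant sc.
  move=> t; apply: (@tlift_inj _ _ _ (c t)).
  have -> : tlift (c t) (mdiff AR AG c t 1) = tmap AR t c 1 by [].
  rewrite tmapM //; last exact: s1.
  rewrite tmapV //; last exact: s2.
  rewrite (tmap_ops o1) (tmap_ops o2) tinvE tmulE /= addNr.
  by rewrite /tlift mc_right0.
apply/funext => t; pose n := Num.bound (`|t| / e).
have n0 : 0 < n%:R :> R.
  by apply: le_lt_trans (archi_boundP _); rewrite divr_ge0 // ltW.
have tn : `|t / n%:R| < e.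
  rewrite normrM normfV (gtr0_norm n0) ltr_pdivrMr // mulrC -ltr_pdivrMr //.
  by apply: archi_boundP; rewrite divr_ge0 // ltW.
have tE : t = n%:R * (t / n%:R) by rewrite mulrC divfK // gt_eqF.
move: tn tE; set s := t / n%:R => tn ->.
suff e12 : c1 s = c2 s by rewrite (opsMn o1) (opsMn o2) e12.
have hc : ((c2 s)^-1 * c1 s = 1)%g.
  by rewrite [LHS](he _ tn) /c (ops0 o1) (ops0 o2) mulVg.
by rewrite -(mulVKg (c2 s) (c1 s)) hc mulg1.
Qed.

Lemma lie_exp_ops (c : R^o -> G) X : one_param_subgroup c X -> lie_exp G X = c 1.
Proof.
move=> o; rewrite /lie_exp; case: xgetP => [g _ [c' o' <-]|/(_ (c 1))[]].
  by rewrite (ops_uniq o o').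
by exists c.
Qed.

Lemma ops_trivial : one_param_subgroup (fun=> 1%g : G) 0.
Proof.
split; [by move=> t _; exact: smooth_at_cst|by move=> *; rewrite mulg1|].
exact: mdiff_cst.
Qed.

Lemma lie_exp0 : lie_exp G 0 = 1%g.
Proof. by rewrite (lie_exp_ops ops_trivial). Qed.

(* [lie_exp] takes the junk value 1 at [X] and at [X / 2] if no one-parameter
   subgroup has velocity [X], which contradicts injectivity near 0. *)
Lemma ops_exists (O : set 'rV[R]_d) : open O -> O 0 -> star_shaped O ->
  {in O &, injective (@lie_exp R d G)} ->
  forall X, exists c : R^o -> G, one_param_subgroup c X.
Proof.
move=> oO O0 sO iO.
have inO X : O X -> exists c : R^o -> G, one_param_subgroup c X.
  move=> OX; apply: contrapT => nX.
  have nX2 : ~ exists c : R^o -> G, one_param_subgroup c (2^-1 *: X).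
    move=> [c o]; apply: nX; exists (fun t => c (2 * t)).
    have -> : X = 2 *: (2^-1 *: X) by rewrite scalerA divff ?scale1r // pnatr_eq0.
    exact: ops_scale.
  have junk Y : (~ exists c : R^o -> G, one_param_subgroup c Y) -> lie_exp G Y = 1%g.
    move=> nY; rewrite /lie_exp; case: xgetP => // g _ [c o _].
    by case: nY; exists c.
  have OX2 : O (2^-1 *: X).
    by apply: sO => //; rewrite invr_ge0 ler0n /= invf_le1 // ler1n.
  (* Both exponentials are the default value 1. A vector equal to its half is 0, and 0 does have a
     one-parameter subgroup. *)
  have e : 2^-1 *: X = X.
    by apply: iO; rewrite ?inE // (junk _ nX) (junk _ nX2).
  apply: nX; exists (fun=> 1%g); rewrite (_ : X = 0); first exact: ops_trivial.
  have : (2^-1 - 1) *: X = 0 by rewrite scalerBl e scale1r subrr.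
  move/eqP; rewrite scaler_eq0 => /orP[|/eqP //].
  by rewrite subr_eq0 invr_eq1 (eqr_nat R 2 1).
move=> X.
have : \forall a \near (0 : R^o), O (a *: X).
  have := @scalel_continuous R 'rV[R]_d X 0.
  apply; rewrite scale0r; exact: open_nbhs_nbhs.
move=> /nbhs_ballP[e /= e0 he].
have OX : O ((e / 2) *: X).
  apply: he; rewrite /ball /= sub0r normrN gtr0_norm ?divr_gt0 //.
  by rewrite ltr_pdivrMr // ltr_pMr // ltr1n.
have [c o] := inO _ OX; exists (fun t => c ((e / 2)^-1 * t)).
have -> : X = (e / 2)^-1 *: ((e / 2) *: X).
  by rewrite scalerA mulVf ?scale1r // gt_eqF // divr_gt0.
exact: ops_scale.
Qed.

Section Exp.
Hypothesis ops_ex : forall X, exists c : R^o -> G, one_param_subgroup c X.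

Lemma lie_exp_one_param X : one_param_subgroup (fun t : R^o => lie_exp G (t *: X)) X.
Proof.
have [c o] := ops_ex X.
rewrite (_ : (fun t => _) = c) //; apply/funext => t.
by rewrite (lie_exp_ops (ops_scale o t)) mulr1.
Qed.

Lemma lie_exp_Ad g X : lie_exp G (Ad g X) = (g * lie_exp G X * g^-1)%g.
Proof.
by rewrite (lie_exp_ops (ops_conj (lie_exp_one_param X) g)) scale1r.
Qed.

Lemma lie_expN X : lie_exp G (- X) = (lie_exp G X)^-1%g.
Proof. by have := opsN (lie_exp_one_param X) 1; rewrite scaleN1r scale1r. Qed.

Lemma lie_exp_half X : lie_exp G X = (lie_exp G (2^-1 *: X) * lie_exp G (2^-1 *: X))%g.
Proof.
have [_ cD _] := lie_exp_one_param X.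
have e : (2^-1 + 2^-1 : R) *: X = X by rewrite -[2^-1]div1r -splitr scale1r.
by rewrite -{1}e; exact: cD.
Qed.

End Exp.
End Exponential.

(** * The two-form on partial products *)

Section Prefix.
Variable H : groupType.

Definition prefix_prod m (x : 'I_m -> H) (j : nat) : H := (\prod_(i < m | (i < j)%N) x i)%g.

Lemma prefix_prod0 m (x : 'I_m -> H) : prefix_prod x 0 = 1%g.
Proof. by rewrite /prefix_prod big_pred0. Qed.

Lemma prefix_prodS m (x : 'I_m -> H) (k : 'I_m) :
  prefix_prod x k.+1 = (prefix_prod x k * x k)%g.
Proof.
rewrite /prefix_prod (big_ord_narrow (ltn_ord k)) big_ord_recr /=.
rewrite (big_ord_narrow (ltnW (ltn_ord k))) /=.
congr (_ * x _)%g; last exact: val_inj.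
by apply: eq_bigr => i _; congr x; apply: val_inj.
Qed.

Lemma conj_square (x y : H) : (y * x * y^-1 * (y * x * y^-1) = y * (x * x) * y^-1)%g.
Proof. by rewrite !mulgA mulgVK. Qed.

Lemma prefix_prodT m (x : 'I_m -> H) : prefix_prod x m = (\prod_(i < m) x i)%g.
Proof. by apply: eq_bigl => i; rewrite ltn_ord. Qed.

Lemma letter_act_lo m (k : 'I_m.-1) (x : 'I_m -> H) :
  letter_act (k, true) x (strand_lo k) =
    (x (strand_lo k) * x (strand_hi k) * (x (strand_lo k))^-1)%g.
Proof. by rewrite /letter_act eqxx. Qed.

Lemma letter_act_hi m (k : 'I_m.-1) (x : 'I_m -> H) :
  letter_act (k, true) x (strand_hi k) = x (strand_lo k).
Proof. by rewrite /letter_act eq_sym (negbTE (strand_lo_neq_hi k)) eqxx. Qed.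

Lemma letter_act_other m l (x : 'I_m -> H) i :
  i != strand_lo l.1 -> i != strand_hi l.1 -> letter_act l x i = x i.
Proof. by rewrite /letter_act => /negbTE -> /negbTE ->. Qed.

(** The pair [(g, h)] becomes [(g h g^-1, g)], with the same product, so only the partial product
    ending between the two strands can change. *)
Lemma prefix_prod_letter m (k : 'I_m.-1) (x : 'I_m -> H) j : (j <= m)%N ->
  j != k.+1 -> prefix_prod (letter_act (k, true) x) j = prefix_prod x j.
Proof.
have Hk j' : (j' <= k)%N -> prefix_prod (letter_act (k, true) x) j' = prefix_prod x j'.
  elim: j' => [|j' IH] hj; first by rewrite !prefix_prod0.
  have jm : (j' < m)%N by have := strand_lo_subproof k; lia.
  rewrite -[j']/(nat_of_ord (Ordinal jm)) !prefix_prodS /= IH; last lia.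
  by rewrite letter_act_other //= -val_eqE /=; apply/eqP; lia.
have Hk2 : prefix_prod (letter_act (k, true) x) k.+2 = prefix_prod x k.+2.
  rewrite -[k.+1]/(nat_of_ord (strand_hi k)) !prefix_prodS letter_act_hi /=.
  rewrite -[nat_of_ord k]/(nat_of_ord (strand_lo k)) !prefix_prodS letter_act_lo /=.
  by rewrite Hk // !mulgA mulgVK.
elim: j => [|j IH] hj jk; first by rewrite !prefix_prod0.
have [jk'|jk'] := leqP j.+1 k; first exact: Hk.
have [->|jk2] := eqVneq j k.+1; first exact: Hk2.
rewrite -[j]/(nat_of_ord (Ordinal hj)) !prefix_prodS /= IH ?(ltnW hj) //.
by rewrite letter_act_other //= -val_eqE /=; apply/eqP; lia.
Qed.

Lemma prod_word_act m (w : braid_word m) (x : 'I_m -> H) :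
  (\prod_(i < m) word_act w x i = \prod_(i < m) x i)%g.
Proof.
have pos k (y : 'I_m -> H) : (\prod_(i < m) letter_act (k, true) y i = \prod_(i < m) y i)%g.
  rewrite -(prefix_prodT (letter_act (k, true) y)) -(prefix_prodT y) prefix_prod_letter //.
  by have := strand_hi_subproof k; lia.
elim: w => [//|[k [] w IH]] /=; first by rewrite pos IH.
by rewrite -(pos k) letter_actK IH.
Qed.

(** Going outwards from the middle, the factor at [n + e] is the inverse of the factor at
    [n - e - 1] and undoes it. It is applied in G to get total product 1 on Lambda, and in the
    tangent group to reflect velocities. *)
Lemma prefix_prod_rev n (x : 'I_(2 * n) -> H) :
  (forall i, x (rev_ord i) = (x i)^-1%g) ->
  forall j, (j <= 2 * n)%N -> prefix_prod x (2 * n - j) = prefix_prod x j.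
Proof.
move=> xr.
have He e : (e <= n)%N -> prefix_prod x (n + e) = prefix_prod x (n - e).
  elim: e => [|e IH] he; first by rewrite addn0 subn0.
  have h1 : (n + e < 2 * n)%N by lia.
  have h2 : (n - e.+1 < 2 * n)%N by lia.
  have er : x (Ordinal h1) = (x (Ordinal h2))^-1%g.
    by rewrite -xr; congr x; apply: val_inj => /=; lia.
  rewrite addnS -[(n + e)%N]/(nat_of_ord (Ordinal h1)) prefix_prodS er /=.
  rewrite IH; last lia.
  have -> : (n - e = (Ordinal h2).+1)%N by rewrite /=; lia.
  by rewrite prefix_prodS mulgK.
move=> j hj; have [jn|nj] := leqP j n.
  have -> : (2 * n - j = n + (n - j))%N by lia.
  rewrite He; last lia.
  by congr prefix_prod; lia.
have -> : (2 * n - j = n - (j - n))%N by lia.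
rewrite -He; last lia.
by congr prefix_prod; lia.
Qed.

End Prefix.

Section PrefixMorphism.
Variables (H H' : groupType) (f : H -> H').
Hypothesis fM : {morph f : x y / (x * y)%g}.

Lemma prefix_prod_morph m (x : 'I_m -> H) j :
  f (prefix_prod x j) = prefix_prod (f \o x) j.
Proof.
apply: (big_morph f fM).
by apply: (@mulgI _ (f 1%g)); rewrite mulg1 -fM mulg1.
Qed.

End PrefixMorphism.

(** * Braid invariance and reflection symmetry of the pairing *)

Section PairingForm.
Variables (R : realType) (d : nat) (G : lieGroupType R d).
Variable dot : invariant_inner_product G.
Local Notation TG := (tangent_group G).

Implicit Types X Y Z : 'rV[R]_d.

Lemma dotDl X Y Z : dot (X + Y) Z = dot X Z + dot Y Z.
Proof. by rewrite -[X]scale1r ip_linear mul1r scale1r. Qed.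
Lemma dot0l Z : dot 0 Z = 0.
Proof. by apply: (@addrI _ (dot 0 Z)); rewrite -dotDl !addr0. Qed.
Lemma dotNl X Z : dot (- X) Z = - dot X Z.
Proof. by apply: (@addrI _ (dot X Z)); rewrite -dotDl !subrr dot0l. Qed.
Lemma dotDr X Y Z : dot Z (X + Y) = dot Z X + dot Z Y.
Proof. by rewrite ip_sym dotDl !(ip_sym dot Z). Qed.
Lemma dotNr X Z : dot Z (- X) = - dot Z X.
Proof. by rewrite ip_sym dotNl ip_sym. Qed.
Lemma dot0r Z : dot Z 0 = 0.
Proof. by rewrite ip_sym dot0l. Qed.

Definition shift_sum m (x : 'I_m -> TG) (j : nat) : 'rV[R]_d := (prefix_prod x j).2.

(* [-2] times the value of [omega_c] on a pair of tangent vectors [x], [y] with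
   the same base point *)
Definition pairing m (x y : 'I_m -> TG) : R :=
  \sum_(j < m) (dot (shift_sum x j) (shift_sum y j.+1)
    - dot (shift_sum x j.+1) (shift_sum y j)).

Lemma shift_sum0 m (x : 'I_m -> TG) : shift_sum x 0 = 0.
Proof. by rewrite /shift_sum prefix_prod0. Qed.

Lemma shift_sumS m (x : 'I_m -> TG) (k : 'I_m) :
  shift_sum x k.+1 = shift_sum x k + Ad (prefix_prod x k).1 (x k).2.
Proof. by rewrite /shift_sum prefix_prodS. Qed.

Lemma fst_morph : {morph (fun x : TG => x.1) : x y / (x * y)%g}.
Proof. by []. Qed.

Lemma prefix_prod_base m (x y : 'I_m -> TG) j :
  (forall i, (x i).1 = (y i).1) -> (prefix_prod x j).1 = (prefix_prod y j).1.
Proof.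
move=> xy; rewrite !(prefix_prod_morph fst_morph).
by congr prefix_prod; apply/funext.
Qed.

Variable z : G.
Hypothesis z_central : in_center z.

Lemma Ad_central (g : G) X : in_center g -> Ad g X = X.
Proof.
move=> gc; rewrite /Ad (_ : (fun h : G => _) = id) ?mdiff_idG //.
by apply/funext => h; rewrite gc mulgK.
Qed.

Local Opaque Ad.

(* the tangent bundle of the set of square roots of [z] *)
Definition tangent_root (x : TG) := (x * x)%g = (z, 0).

Lemma tangent_rootP x : tangent_root x <->
  (x.1 * x.1)%g = z /\ Ad x.1 x.2 = - x.2.
Proof.
rewrite /tangent_root tmulE; split=> [[-> /eqP]|[-> ->]]; last by rewrite subrr.
by rewrite addrC addr_eq0 => /eqP ->.
Qed.

Lemma Ad_root (g : G) X : (g * g)%g = z -> Ad g (Ad g X) = X.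
Proof. by move=> gz; rewrite -AdM gz Ad_central. Qed.

Lemma tangent_root_conj x y : tangent_root x -> tangent_root (y * x * y^-1)%g.
Proof.
move=> hx; rewrite /tangent_root conj_square hx.
(* Centrality of [z] makes [Ad z] trivial, so [(z, 0)] is central in the tangent group as well. *)
have zy : commute (y : TG) ((z, 0) : TG).
  rewrite /commute !tmulE /= linear0 addr0 add0r Ad_central //.
  by rewrite (z_central y.1).
by rewrite zy; exact: mulgK.
Qed.

Lemma tangent_root_letter m l (x : 'I_m -> TG) :
  (forall i, tangent_root (x i)) -> forall i, tangent_root (letter_act l x i).
Proof.
move=> hx i; rewrite /letter_act.
case: ifP => _; first by case: l.2 => //; exact: tangent_root_conj.
case: ifP => _ //; case: l.2 => //.
by rewrite -{2}(invgK (x (strand_hi l.1))); exact: tangent_root_conj.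
Qed.

(** Bilinear expansion leaves u.b - a.w + u.b' - a.b' - a'.w + a'.b as the difference of the two
    sides; the hypotheses cancel it in pairs. Here [u] and [w] are the extra terms that the
    conjugating factor g^-1 contributes to the changed partial sums. *)
Lemma exchange_identity A B a a' u b b' w :
  dot u b = dot a w -> dot u b' = dot a b' -> dot a' w = dot a' b ->
  dot A (B + (b + b' + w)) - dot (A + (a + a' + u)) B +
    (dot (A + (a + a' + u)) (B + b + b') - dot (A + a + a') (B + (b + b' + w)))
  = dot A (B + b) - dot (A + a) B +
    (dot (A + a) (B + b + b') - dot (A + a + a') (B + b)).
Proof. by move=> e1 e2 e3; rewrite !(dotDl, dotDr) e1 e2 e3; ring. Qed.

(* An elementary braid changes only one partial sum, namely [A + Ad p a] into
   [A + Ad p (mid a a')]; the two sides collect the terms of [pairing] in which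
   that sum occurs. *)
Lemma pairing_exchange (p g h : G) A B a a' b b' :
  (g * g)%g = z -> (h * h)%g = z -> Ad g a = - a -> Ad h a' = - a' ->
  Ad g b = - b -> Ad h b' = - b' ->
  let mid c c' := c + Ad g c' + Ad (g * h)%g (- Ad g^-1%g c) in
  let fin C c c' := C + Ad p c + Ad p (Ad g c') in
  dot A (B + Ad p (mid b b')) - dot (A + Ad p (mid a a')) B +
    (dot (A + Ad p (mid a a')) (fin B b b') - dot (fin A a a') (B + Ad p (mid b b')))
  = dot A (B + Ad p b) - dot (A + Ad p a) B +
    (dot (A + Ad p a) (fin B b b') - dot (fin A a a') (B + Ad p b)).
Proof.
move=> gz hz ag ah bg bh mid fin; rewrite {}/mid {}/fin.
have inv c : Ad g c = - c -> - Ad g^-1%g c = c.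
  by move=> e; rewrite -{1}[c]opprK -e linearN /= -AdM mulVg Ad1 opprK.
rewrite (inv a ag) (inv b bg) !AdM !linearD /= {inv}.
(* [Ad g] and [Ad h] are isometries and involutions, hence self-adjoint; paired with a vector of the
   -1 eigenspace they act as -1. *)
have F1 c c' : Ad h c' = - c' -> dot (Ad h c) c' = - dot c c'.
  by move=> e; rewrite -(ip_Ad dot h) Ad_root // e dotNr.
have F2 c c' : Ad g c' = - c' -> dot (Ad g c) c' = - dot c c'.
  by move=> e; rewrite -(ip_Ad dot g) Ad_root // e dotNr.
have F4 : dot (Ad h a) b = dot (Ad h b) a.
  by rewrite -(ip_Ad dot h) Ad_root // ip_sym.
have G1 := F1 a b' bh; have G2 := F1 b a' ah.
have G3 := F2 a' b bg; have G4 := F2 b' a ag.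
have G5 := F2 (Ad h a) b bg; have G6 := F2 (Ad h b) a ag.
apply: exchange_identity.
- rewrite [LHS]ip_Ad [RHS]ip_Ad [LHS]G5 [RHS]ip_sym [RHS]G6.
  exact: (congr1 -%R F4).
- rewrite [LHS]ip_Ad [RHS]ip_Ad [LHS]ip_Ad [LHS]G1 [RHS]ip_sym [RHS]G4.
  exact: (congr1 -%R (ip_sym _ _ _)).
- rewrite [LHS]ip_Ad [RHS]ip_Ad [LHS]ip_Ad [LHS]ip_sym [LHS]G2 [RHS]G3.
  exact: (congr1 -%R (ip_sym _ _ _)).
Qed.

Lemma pairing_letter_true m k (x y : 'I_m -> TG) :
  (forall i, tangent_root (x i)) -> (forall i, tangent_root (y i)) ->
  (forall i, (x i).1 = (y i).1) ->
  pairing (letter_act (k, true) x) (letter_act (k, true) y) = pairing x y.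
Proof.
move=> rx ry xy; rewrite /pairing.
have hl : strand_hi k != strand_lo k by rewrite eq_sym strand_lo_neq_hi.
(* The summand at [j] involves the partial sums at [j] and [j.+1], so the changed sum, at [k.+1],
   occurs only in the summands of the two crossing strands. *)
rewrite (bigD1 (strand_lo k)) //= (bigD1 (strand_hi k)) //=.
rewrite [RHS](bigD1 (strand_lo k)) //= [in RHS](bigD1 (strand_hi k)) //=.
have km := strand_hi_subproof k.
have out (w : 'I_m -> TG) j : (j <= m)%N -> j != k.+1 ->
    shift_sum (letter_act (k, true) w) j = shift_sum w j.
  by move=> jm jk; rewrite /shift_sum prefix_prod_letter.
rewrite [LHS]addrA [RHS]addrA; apply: f_equal2; last first.
  apply: eq_bigr => i /andP[il ih]; have im := ltn_ord i.
  have ik : (i : nat) != k by [].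
  have ik1 : (i : nat) != k.+1 by [].
  by rewrite !out // ?eqSS //; exact: ltnW.
have S1 w : shift_sum w k.+1 = shift_sum w k +
    Ad (prefix_prod w k).1 (w (strand_lo k)).2.
  exact: (shift_sumS w (strand_lo k)).
have S2 (w : 'I_m -> TG) : shift_sum w k.+2 = shift_sum w k +
    Ad (prefix_prod w k).1 (w (strand_lo k)).2 +
    Ad (prefix_prod w k).1 (Ad (w (strand_lo k)).1 (w (strand_hi k)).2).
  have e : prefix_prod w (strand_hi k) = (prefix_prod w k * w (strand_lo k))%g.
    exact: (prefix_prodS w (strand_lo k)).
  have := shift_sumS w (strand_hi k); rewrite e => ->.
  by apply: f_equal2; [exact: S1|exact: AdM].
have S1' (w : 'I_m -> TG) : shift_sum (letter_act (k, true) w) k.+1 = shift_sum w k +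
    Ad (prefix_prod w k).1 ((w (strand_lo k)).2 +
      Ad (w (strand_lo k)).1 (w (strand_hi k)).2 +
      Ad ((w (strand_lo k)).1 * (w (strand_hi k)).1)%g
        (- Ad ((w (strand_lo k)).1)^-1%g (w (strand_lo k)).2)).
  rewrite S1 letter_act_lo out; [|lia|by apply/eqP; lia].
  by rewrite prefix_prod_letter //; [lia|apply/eqP; lia].
have k0 : (k <= m)%N by lia.
have k1 : k != k.+1 :> nat by apply/eqP; lia.
have k2 : k.+2 != k.+1 by apply/eqP; lia.
rewrite !(out _ k k0 k1) !(out _ k.+2 km k2) !S1' !S2 !S1.
rewrite -(prefix_prod_base k xy) -!xy.
have [gz ag] := (tangent_rootP _).1 (rx (strand_lo k)).
have [hz ah] := (tangent_rootP _).1 (rx (strand_hi k)).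
have [_ bg] := (tangent_rootP _).1 (ry (strand_lo k)).
have [_ bh] := (tangent_rootP _).1 (ry (strand_hi k)).
rewrite -xy in bg; rewrite -xy in bh.
exact: (pairing_exchange (prefix_prod x k).1 (shift_sum x k) (shift_sum y k) gz hz ag ah bg bh).
Qed.

Lemma letter_base m l (x y : 'I_m -> TG) :
  (forall i, (x i).1 = (y i).1) ->
  forall i, (letter_act l x i).1 = (letter_act l y i).1.
Proof. by move=> xy i; rewrite /letter_act; do 2?case: ifP => _; rewrite -?xy //=; case: l.2; rewrite /= -?xy. Qed.

Lemma tangent_root_word m w (x : 'I_m -> TG) :
  (forall i, tangent_root (x i)) -> forall i, tangent_root (word_act w x i).
Proof. by move=> hx; elim: w => //= l w IH; exact: tangent_root_letter. Qed.

Lemma word_base m w (x y : 'I_m -> TG) :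
  (forall i, (x i).1 = (y i).1) ->
  forall i, (word_act w x i).1 = (word_act w y i).1.
Proof. by move=> xy; elim: w => //= l w IH; exact: letter_base. Qed.

Lemma pairing_word m w (x y : 'I_m -> TG) :
  (forall i, tangent_root (x i)) -> (forall i, tangent_root (y i)) ->
  (forall i, (x i).1 = (y i).1) ->
  pairing (word_act w x) (word_act w y) = pairing x y.
Proof.
move=> rx ry xy; elim: w => [//|l w IH].
have rx' := tangent_root_word w rx; have ry' := tangent_root_word w ry.
have xy' := word_base w xy.
case: l => k [] /=; first by rewrite pairing_letter_true.
(* For an inverse letter, applying the positive letter to both arguments does not change the pairing
   and cancels the inverse. *)
rewrite -[LHS](@pairing_letter_true _ k).
- by rewrite !letter_actK.
- exact: tangent_root_letter.
- exact: tangent_root_letter.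
- exact: letter_base.
Qed.

Lemma double_eq0 (a : R) : a = - a -> a = 0.
Proof. by move=> /eqP; rewrite -subr_eq0 opprK -mulr2n mulrn_eq0 => /eqP. Qed.

(** Reindexing by [rev_ord] exchanges the roles of [j] and [j.+1], and the summand is antisymmetric
    under that exchange. *)
Lemma pairing_rev m (x y : 'I_m -> TG) :
  (forall j, (j <= m)%N -> shift_sum x (m - j) = shift_sum x j) ->
  (forall j, (j <= m)%N -> shift_sum y (m - j) = shift_sum y j) ->
  pairing x y = 0.
Proof.
move=> hx hy; apply: double_eq0.
rewrite {1}/pairing (reindex_inj rev_ord_inj) /= -sumrN; apply: eq_bigr => i _.
have im := ltn_ord i.
have e : (m - i.+1).+1 = (m - i)%N by lia.
by rewrite e !hx ?hy //; [ring|exact: ltnW|exact: ltnW].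
Qed.

Lemma pairing_revN m (x y : 'I_m -> TG) :
  (forall j, (j <= m)%N -> shift_sum x (m - j) = shift_sum x m - shift_sum x j) ->
  (forall j, (j <= m)%N -> shift_sum y (m - j) = shift_sum y m - shift_sum y j) ->
  pairing x y = 0.
Proof.
move=> hx hy; apply: double_eq0.
set X := shift_sum x m; set Y := shift_sum y m.
(* Besides the change of sign, the reflection produces increments of one family paired with the
   total of the other. Both such sums telescope to [dot X Y] and enter with opposite signs. *)
have telX : \sum_(i < m) (dot (shift_sum x i.+1) Y - dot (shift_sum x i) Y) = dot X Y.
  rewrite -(big_mkord xpredT (fun i => dot (shift_sum x i.+1) Y - dot (shift_sum x i) Y)).
  by rewrite telescope_sumr // shift_sum0 dot0l subr0.
have telY : \sum_(i < m) (dot X (shift_sum y i.+1) - dot X (shift_sum y i)) = dot X Y.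
  rewrite -(big_mkord xpredT (fun i => dot X (shift_sum y i.+1) - dot X (shift_sum y i))).
  by rewrite telescope_sumr // shift_sum0 dot0r subr0.
have -> : - pairing x y = - pairing x y
  + \sum_(i < m) (dot X (shift_sum y i.+1) - dot X (shift_sum y i))
  - \sum_(i < m) (dot (shift_sum x i.+1) Y - dot (shift_sum x i) Y).
  by rewrite telX telY; ring.
rewrite {1}/pairing (reindex_inj rev_ord_inj) /= -sumrN -big_split /= -sumrB.
apply: eq_bigr => i _; have im := ltn_ord i.
have e : (m - i.+1).+1 = (m - i)%N by lia.
rewrite e !hx ?hy //; [|exact: ltnW|exact: ltnW].
rewrite -/X -/Y !(dotDl, dotDr, dotNl, dotNr); ring.
Qed.

End PairingForm.

(** * The form omega_C where the total product is 1 *)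

Section Lifts.
Variables (R : realType) (d : nat) (G : lieGroupType R d).
Local Notation AG := (@lie_charts R d G).
Local Notation TG := (tangent_group G).
Local Hint Resolve lie_regular : core.

Section AtPoint.
Variables (E : normedModType R) (M : topologicalType) (A : charts E M) (p : M).
Hypothesis rA : regular_chart A p.

Lemma tmap_prod (I : Type) (s : seq I) (P : pred I) (f : I -> M -> G) :
  (forall i, smooth_at A AG (f i) p) ->
  smooth_at A AG (fun x => \prod_(i <- s | P i) f i x)%g p /\
  forall u, tmap A p (fun x => \prod_(i <- s | P i) f i x)%g u =
    (\prod_(i <- s | P i) tmap A p (f i) u)%g.
Proof.
move=> sf; elim: s => [|i s [IH1 IH2]].
  under eq_fun do rewrite big_nil.
  by split=> [|u]; [exact: smooth_at_cst|rewrite big_nil tmap1].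
under eq_fun do rewrite big_cons.
split=> [|u]; last rewrite big_cons; case: (P i) => //.
- exact: smooth_at_mul.
- by rewrite tmapM // IH2.
Qed.

Lemma tmap_word m (w : braid_word m) (F : M -> 'I_m -> G) :
  (forall i, smooth_at A AG (fun x => F x i) p) ->
  forall i, smooth_at A AG (fun x => word_act w (F x) i) p /\
  forall u, tmap A p (fun x => word_act w (F x) i) u =
    word_act w (fun j => tmap A p (fun x => F x j) u) i.
Proof.
move=> sF; elim: w => [|l w IH] i /=; first by split; [exact: sF|].
have s1 j : smooth_at A AG (fun x => word_act w (F x) j) p by have [] := IH j.
have t1 j u : tmap A p (fun x => word_act w (F x) j) u =
  word_act w (fun j => tmap A p (fun x => F x j) u) j by have [_ ->] := IH j.
rewrite /letter_act; case: (i == strand_lo l.1); last case: (i == strand_hi l.1) => //;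
  case: l.2 => //.
- have sm := smooth_at_mul rA (s1 (strand_lo l.1)) (s1 (strand_hi l.1)).
  have si := smooth_at_inv rA (s1 (strand_lo l.1)).
  split=> [|u]; first exact: smooth_at_mul sm si.
  by rewrite (tmapM rA u sm si) tmapM // tmapV // !t1.
- have si := smooth_at_inv rA (s1 (strand_hi l.1)).
  have sm := smooth_at_mul rA si (s1 (strand_lo l.1)).
  split=> [|u]; first exact: smooth_at_mul sm (s1 (strand_hi l.1)).
  by rewrite (tmapM rA u sm (s1 _)) tmapM // tmapV // !t1.
Qed.

End AtPoint.

Section Power.
Variable m : nat.
Local Notation Gm := {ptws 'I_m -> G}.
Local Notation AGm := (pow_charts AG m).
Implicit Types (q : Gm) (u v : 'M[R]_(m, d)).

Lemma pow_lie_regular q : regular_chart AGm q.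
Proof. exact: pow_regular. Qed.
Local Hint Resolve pow_lie_regular : core.

Definition tlifts q u (i : 'I_m) : TG := tlift (q i) (row i u).

Lemma smooth_proj q i : smooth_at AGm AG (fun h : Gm => h i) q.
Proof. by have [] := is_smooth_proj (p := q) i (fun j => lie_regular (q j)). Qed.

Lemma tmap_proj q u i : tmap AGm q (fun h : Gm => h i) u = tlifts q u i.
Proof.
have [_ h] := is_smooth_proj (p := q) i (fun j => lie_regular (q j)).
by rewrite /tmap h.
Qed.

Lemma tlifts_inj q : injective (tlifts q).
Proof.
move=> u v uv; apply/row_matrixP => i.
exact: (@tlift_inj _ _ _ (q i) _ _ (congr1 (@^~ i) uv)).
Qed.

Lemma smooth_word (w : braid_word m) :
  smooth_on AGm AGm setT (word_act w : Gm -> Gm).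
Proof.
move=> q _; have h i := tmap_word (pow_lie_regular q) w (smooth_proj q) i.
by have [] := @is_smooth_ptws _ _ _ _ _ _ _ AGm (word_act w : Gm -> Gm) q
  (fun i => mdiff AGm AG (fun x : Gm => word_act w x i) q)
  (fun i => smooth_at_is_smooth (proj1 (h i))).
Qed.

(** This turns the pullback of omega_C along a braid into [word_act] on lifted vectors, to which
    [pairing_word] applies. *)
Lemma tlifts_word (w : braid_word m) q u :
  tlifts (word_act w q) (mdiff AGm AGm (word_act w : Gm -> Gm) q u) =
    word_act w (tlifts q u).
Proof.
have h i := tmap_word (pow_lie_regular q) w (smooth_proj q) i.
have [_ e] := @is_smooth_ptws _ _ _ _ _ _ _ AGm (word_act w : Gm -> Gm) q
  (fun i => mdiff AGm AG (fun x : Gm => word_act w x i) q)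
  (fun i => smooth_at_is_smooth (proj1 (h i))).
apply/funext => i; rewrite /tlifts e rowK.
have [_ hi] := h i.
transitivity (word_act w (fun j => tmap AGm q (fun x : Gm => x j) u) i).
  by rewrite -hi.
by congr (word_act w _ i); apply/funext => j; rewrite tmap_proj.
Qed.

Lemma tmap_prefix q u j :
  smooth_at AGm AG (fun h : Gm => prefix_prod h j) q /\
  tmap AGm q (fun h : Gm => prefix_prod h j) u = prefix_prod (tlifts q u) j.
Proof.
have [s h] := tmap_prod (pow_lie_regular q) (index_enum 'I_m)
  (fun i : 'I_m => (i < j)%N) (smooth_proj q).
split=> //; rewrite [LHS]h; apply: eq_bigr => i _; exact: tmap_proj.
Qed.

Lemma tlifts_prefix_base q u j : (prefix_prod (tlifts q u) j).1 = prefix_prod q j.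
Proof. by rewrite (prefix_prod_morph (@fst_morph R d G)). Qed.

Variable dot : invariant_inner_product G.

Lemma omega_c_pairing q u v :
  omega_c dot q u v = - (pairing dot (tlifts q u) (tlifts q v) / 2).
Proof.
rewrite /omega_c /pairing mulr_suml; congr (- _).
(* [pairing] also sums over the index 0, where the term vanishes because the empty partial sums are
   0. *)
rewrite [RHS](bigID (fun j : 'I_m => (0 < j)%N)) /= [X in _ + X]big1 ?addr0; last first.
  move=> j; rewrite lt0n negbK => /eqP ->; rewrite !shift_sum0 dot0l dot0r.
  by rewrite subrr mul0r.
apply: eq_bigr => j _; rewrite /pullback.
have [sP _] := tmap_prefix q u j.
have [_ hE] := is_smooth_pair (smooth_at_is_smooth sP)
  (is_smooth_proj (p := q) j (fun j => lie_regular (q j))).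
have hE' w : mdiff AGm (prod_charts AG AG) (E_map j) q w =
  (mdiff AGm AG (fun h : Gm => prefix_prod h j) q w, row j w) by exact: hE.
rewrite !hE' /Omega /= {hE hE'}.
(* By invariance of the inner product, the [Ad] of the inverse prefix moves to the other argument,
   where it turns the velocity of strand [j] into the increment of the partial sums. The products of
   the two [j]-th partial sums then cancel. *)
have mcl w : mc_left (prefix_prod q j) (mdiff AGm AG (fun h : Gm => prefix_prod h j) q w)
    = Ad (prefix_prod q j)^-1%g (shift_sum (tlifts q w) j).
  rewrite mc_left_Ad; congr Ad; have [_ e] := tmap_prefix q w j.
  by rewrite /shift_sum -e.
have E1 : E_map j q = (prefix_prod q j, q j) by [].
rewrite [mc_left _ _ in X in X - _]mcl [mc_left _ _ in X in _ - X]mcl.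
have dl X Y : dot (Ad (prefix_prod q j)^-1%g X) Y = dot X (Ad (prefix_prod q j) Y).
  by rewrite -[LHS](ip_Ad dot (prefix_prod q j)) -AdM mulgV Ad1.
rewrite dl [dot (mc_right _ _) _]ip_sym dl.
rewrite !shift_sumS !tlifts_prefix_base /tlifts /tlift /=.
congr (_ / 2); rewrite [in RHS]dotDl [in RHS]dotDr.
rewrite [dot (Ad _ _) _]ip_sym; ring.
Qed.

Section Root.
Variable z : G.
Hypothesis z_central : in_center z.

Lemma tau_root (g : G) (u v : 'rV[R]_d) : (g * g)%g = z -> tau dot g u v = 0.
Proof.
move=> gz; rewrite /tau; set X := conj_gen g u; set Y := conj_gen g v.
have -> : dot X (Ad g Y) = dot Y (Ad g X).
  by rewrite -[LHS](ip_Ad dot g) (Ad_root z_central) // ip_sym.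
by rewrite subrr mul0r.
Qed.

Lemma mdiff0 (E F : normedModType R) (M N : Type) (A : charts E M)
    (B : charts F N) (f : M -> N) p : mdiff A B f p 0 = 0.
Proof. exact: linear0. Qed.

Lemma left_field0 : left_field G 0 = fun=> 0.
Proof.
apply/funext => x; rewrite /left_field.
have -> : left_translate (chart_inv AG (1%g : G) x) 0 = 0 by exact: mdiff0.
exact: mdiff0.
Qed.

Lemma lie_bracket0l (X : 'rV[R]_d) : lie_bracket G 0 X = 0.
Proof.
have h o : 'd (left_field G 0) o X = 0.
  rewrite left_field0.
  exact: (congr1 (@^~ X) (@diff_cst R _ _ (0 : 'rV[R]_d) o)).
have k o : 'd (left_field G X) o 0 = 0 by exact: linear0.
exact: (etrans (f_equal2 (fun a b => a - b) (k _) (h _)) (subrr _)).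
Qed.

Lemma exp_lambda0l (Z X Y : 'rV[R]_d) : exp_lambda dot Z 0 X Y = 0.
Proof.
rewrite /exp_lambda /lambda_form mdiff0.
have -> : mc_left (lie_exp G Z) 0 = 0 by exact: mdiff0.
by rewrite lie_bracket0l dot0l mul0r.
Qed.

Lemma beta0 (X Y : 'rV[R]_d) : beta dot 0 X Y = 0.
Proof.
rewrite /beta /homotopy3 /Rintegral.
(* The homotopy operator contracts the form with the position vector, which is 0 at the origin. *)
under eq_integral do rewrite exp_lambda0l mulr0.
by rewrite integral0.
Qed.

Lemma omega_C_pairing (O : set 'rV[R]_d) q u v :
  O 0 -> {in O &, injective (@lie_exp R d G)} ->
  (forall i, q i * q i = z)%g -> r_map q = 1%g ->
  omega_C dot O q u v = - (pairing dot (tlifts q u) (tlifts q v) / 2).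
Proof.
move=> O0 iO qz rq; rewrite /omega_C omega_c_pairing /pullback /= rq.
(* Either the choice finds a logarithm of 1 in [O], which injectivity identifies with 0, or it
   returns its default 0. *)
have -> : lie_log O (1%g : G) = 0.
  rewrite /lie_log; case: xgetP => // X _ [OX eX].
  by apply: iO; rewrite ?inE // eX lie_exp0.
rewrite beta0 subr0 big1 ?addr0 // => i _; exact/tau_root.
Qed.

End Root.
End Power.
End Lifts.

(** * Tangent spaces *)

Section TangentSpaces.
Variables (R : realType) (d : nat) (G : lieGroupType R d).
Local Notation AG := (@lie_charts R d G).
Local Notation AR := (vec_charts R^o).
Local Notation TG := (tangent_group G).
Local Hint Resolve lie_regular real_regular : core.

Variables (C : set G) (z : G).
Hypothesis C_root : forall p, C p -> (p * p)%g = z.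
Hypothesis C_conj : conj_invariant C.
Hypothesis ops_ex : forall X, exists c : R^o -> G, one_param_subgroup c X.

Lemma exp_root_conj (p : G) (a : 'rV[R]_d) : Ad p a = - a ->
  (p * lie_exp G a * p^-1 = (lie_exp G a)^-1)%g.
Proof. by move=> pa; rewrite -lie_exp_Ad // pa lie_expN. Qed.

(** Conjugation by [p] inverts e = exp(a/2), so exp(a) p = e e p = e p e^-1 is a conjugate of
    [p]. *)
Lemma exp_root_class (p : G) (a : 'rV[R]_d) : C p -> Ad p a = - a ->
  C (lie_exp G a * p)%g.
Proof.
move=> Cp pa; set e := lie_exp G (2^-1 *: a).
have pe : (p * e * p^-1 = e^-1)%g.
  apply: exp_root_conj.
  by rewrite AdZ pa scalerN.
have -> : (lie_exp G a * p = e * p * e^-1)%g.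
  have pe' : (p * e^-1 = e * p)%g.
    have e' : (p * e^-1 * p^-1 = e)%g.
      by rewrite -[RHS]invgK -[in RHS]pe !invgM invgK mulgA.
    by rewrite -[in RHS]e' mulgVK.
  by rewrite (lie_exp_half ops_ex a) -/e -[RHS]mulgA pe' mulgA.
exact: C_conj.
Qed.

Variable m : nat.
Local Notation Gm := {ptws 'I_m -> G}.
Local Notation AGm := (pow_charts AG m).
Implicit Types (q : Gm) (u v : 'M[R]_(m, d)).

Lemma tangent_curve (S : set Gm) q u : tangent AGm S q u ->
  exists c : R^o -> Gm, [/\ forall i, smooth_at AR AG (fun t => c t i) 0,
    c 0 = q, \forall t \near (0 : R^o), S (c t) &
    forall i, tlifts q u i = tmap AR 0 (fun t => c t i) 1].
Proof.
move=> [e [c [e0 sc c0 cS ->]]].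
have sc0 : smooth_at AR AGm c 0 by apply: sc; rewrite /= normr0.
have h i := is_smooth_comp (real_regular 0) (pow_lie_regular q) c0
  (smooth_at_is_smooth sc0) (is_smooth_proj (p := q) i (fun j => lie_regular (q j))).
exists c; split => //.
- by move=> i; have [] := h i.
- apply/nbhs_ballP; exists e => // t; rewrite /ball /= sub0r normrN => te.
  exact: cS.
- by move=> i; have [_ hi] := h i; rewrite /tmap hi c0.
Qed.

(** Along a curve in the class the square is constantly [z], so the lift of the square is
    [(z, 0)]. *)
Lemma tangent_class_root (S : set Gm) q u i : S `<=` class_pow C ->
  tangent AGm S q u -> tangent_root z (tlifts q u i).
Proof.
move=> SC /tangent_curve[c [sc c0 cS ->]].
rewrite /tangent_root -tmapM // -(tmap_cst AR (0 : R^o) z 1).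
apply: tmap_near => //; last exact: smooth_at_mul.
by apply: filterS cS => t /SC Cc; exact: C_root.
Qed.

(** Supplies the curve demanded by [tangent]: moving each component along the one-parameter subgroup
    of its right-trivialized velocity has derivative [u], so only membership in [S] remains to be
    checked. *)
Lemma tangent_exp_curve (S : set Gm) q u :
  (\forall t \near (0 : R^o),
    S (fun i => (lie_exp G (t *: (tlifts q u i).2) * q i)%g)) ->
  tangent AGm S q u.
Proof.
move=> /nbhs_ballP[e e0 he].
pose c (t : R^o) : Gm := fun i => (lie_exp G (t *: (tlifts q u i).2) * q i)%g.
have o i := lie_exp_one_param ops_ex (tlifts q u i).2.
have s1 i (t : R^o) : smooth_at AR AG (fun t : R^o => lie_exp G (t *: (tlifts q u i).2)) t.
  by have [so _ _] := o i; exact: so.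
have s2 i t : smooth_at AR AG (fun s => c s i) t.
  by apply: smooth_at_mul => //; exact: smooth_at_cst.
have h t := is_smooth_ptws (f := c) (fun i => smooth_at_is_smooth (s2 i t)).
have c0 : c 0 = q by apply/funext => i; rewrite /c scale0r lie_exp0 mul1g.
exists e, c; split => //.
- by move=> t _; have [] := h t.
- by move=> t te; apply: he; rewrite /ball /= sub0r normrN.
- apply: (@tlifts_inj _ _ _ _ q); apply/funext => i.
  have [_ ->] := h 0; rewrite {2}/tlifts rowK.
  have e1 : tlift (q i) (mdiff AR AG (fun s => c s i) 0 1) = tmap AR 0 (fun s => c s i) 1.
    by rewrite /tmap c0.
  have e2 : tmap AR 0 (fun s => c s i) 1 = tlifts q u i.
    apply: (etrans (tmapM (real_regular 0) 1 (s1 i 0) (smooth_at_cst AR AG (q i) 0))).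
    rewrite (tmap_ops (o i)) tmap_cst scale0r lie_exp0.
    by congr pair; [exact: mul1g|rewrite /= linear0 addr0].
  exact: (esym (etrans e1 e2)).
Qed.

Lemma tangent_class_rootP (U : set G) q u : open U -> class_pow C q -> U (r_map q) ->
  tangent AGm (class_pow C `&` r_map (m := m) @^-1` U) q u <->
  forall i, tangent_root z (tlifts q u i).
Proof.
move=> oU Cq Uq; split=> [tu i|hu].
  by apply: tangent_class_root tu => ? [].
apply: tangent_exp_curve.
have cr : \forall t \near (0 : R^o),
    U (\prod_(i < m) (lie_exp G (t *: (tlifts q u i).2) * q i))%g.
  have s1 i : smooth_at AR AG (fun t : R^o => lie_exp G (t *: (tlifts q u i).2)) 0.
    by have [so _ _] := lie_exp_one_param ops_ex (tlifts q u i).2; exact: so.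
  have s2 i : smooth_at AR AG
      (fun t : R^o => lie_exp G (t *: (tlifts q u i).2) * q i)%g 0.
    by apply: smooth_at_mul => //; exact: smooth_at_cst.
  have [[cp _] _] := tmap_prod (real_regular 0) (index_enum 'I_m) xpredT s2.
  apply: cp; apply: open_nbhs_nbhs; split=> //.
  rewrite (eq_bigr q) // => i _.
  by rewrite scale0r lie_exp0 mul1g.
apply: filterS cr => t Ut; split => // i.
have [_ ai] := (tangent_rootP z _).1 (hu i).
have {}ai : Ad (q i) (tlifts q u i).2 = - (tlifts q u i).2 := ai.
apply: exp_root_class; first exact: Cq.
by rewrite AdZ ai scalerN.
Qed.

End TangentSpaces.

(** * The tangent space of Lambda and its maximality *)

Section LambdaTangent.
Variables (R : realType) (d : nat) (G : lieGroupType R d).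
Local Notation AG := (@lie_charts R d G).
Local Notation AR := (vec_charts R^o).
Local Notation TG := (tangent_group G).
Local Hint Resolve lie_regular real_regular : core.

(** Mirror strands contribute equal increments: the base prefix before [rev_ord i] is the one before
    [i] times [(x i).1], and this additional [Ad] sends the reflected velocity [- (x i).2] to
    [(x i).2]. *)
Lemma shift_sum_revN n (x : 'I_(2 * n) -> TG) :
  (forall i, (x (rev_ord i)).1 = ((x i).1)^-1%g) ->
  (forall i, (x (rev_ord i)).2 = - (x i).2) ->
  (forall i, Ad (x i).1 (x i).2 = - (x i).2) ->
  forall j, (j <= 2 * n)%N ->
    shift_sum x (2 * n - j) = shift_sum x (2 * n) - shift_sum x j.
Proof.
move=> x1 x2 xa; suff h j : (j <= 2 * n)%N ->
    shift_sum x (2 * n - j) + shift_sum x j = shift_sum x (2 * n).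
  by move=> j /h <-; rewrite addrK.
elim: j => [|j IH] jn; first by rewrite subn0 shift_sum0 addr0.
rewrite -(IH (ltnW jn)); set i := Ordinal jn.
have er : (2 * n - j = (rev_ord i).+1)%N by rewrite /=; lia.
have er' : (2 * n - j.+1 = rev_ord i)%N by [].
have P : (prefix_prod x (rev_ord i)).1 = ((prefix_prod x j).1 * (x i).1)%g.
  have xr : forall i, ((fun y : TG => y.1) \o x) (rev_ord i) =
    ((((fun y : TG => y.1) \o x)) i)^-1%g by move=> k; exact: x1.
  rewrite !(prefix_prod_morph (@fst_morph R d G)) -er' (prefix_prod_rev xr jn).
  exact: (prefix_prodS ((fun y : TG => y.1) \o x) i).
have e1 : shift_sum x (2 * n - j) =
    shift_sum x (2 * n - j.+1) + Ad (prefix_prod x j).1 (x i).2.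
  rewrite er er' shift_sumS P x2; apply: f_equal2 => //.
  rewrite [LHS]AdM; apply: f_equal2 => //.
  exact: (etrans (linearN (Ad (x i).1) _) (etrans (congr1 -%R (xa i)) (opprK _))).
have e2 : shift_sum x j.+1 = shift_sum x j + Ad (prefix_prod x j).1 (x i).2.
  exact: (shift_sumS x i).
by rewrite e1 e2 -addrA; congr (_ + _); exact: addrC.
Qed.

Variables (C : set G) (z : G).
Hypothesis z_central : in_center z.
Hypothesis C_root : forall p, C p -> (p * p)%g = z.
Hypothesis C_conj : conj_invariant C.
Hypothesis ops_ex : forall X, exists c : R^o -> G, one_param_subgroup c X.
Variable n : nat.
Local Notation m := (2 * n)%N.
Local Notation Gm := {ptws 'I_(2 * n) -> G}.
Local Notation AGm := (pow_charts AG (2 * n)).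
Implicit Types (q : Gm) (u v : 'M[R]_(2 * n, d)).

Lemma Lambda_rev q i : Lambda C q -> q (rev_ord i) = (q i)^-1%g.
Proof.
move=> [_ h]; have [/h //|ni] := ltnP i n.
have := h (rev_ord i); rewrite rev_ordK => -> //; first by rewrite invgK.
by rewrite /=; have := ltn_ord i; lia.
Qed.

Lemma Lambda_r q : Lambda C q -> r_map q = 1%g.
Proof.
move=> Lq; rewrite /r_map -(prefix_prodT q) -[X in prefix_prod q X]subn0.
by rewrite prefix_prod_rev ?prefix_prod0 // => i; exact: Lambda_rev.
Qed.

Lemma tangent_LambdaP q u : Lambda C q ->
  tangent AGm (Lambda C : set Gm) q u <->
  (forall i, tangent_root z (tlifts q u i)) /\
  (forall i, tlifts q u (rev_ord i) = (tlifts q u i)^-1%g).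
Proof.
move=> Lq; split=> [tu|[hu hr]].
  split=> i.
    by apply: (@tangent_class_root _ _ _ C z C_root _ (Lambda C)) => // ? [].
  have [c [sc c0 cS hc]] := tangent_curve tu.
  rewrite (hc (rev_ord i)) (hc i).
  apply: etrans (tmapV (real_regular 0) 1 (sc i)).
  apply: tmap_near (sc (rev_ord i)) => //.
  apply: (@filterS _ _ (nbhs_filter (0 : R^o)) _ _ _ cS) => t Lt.
  exact: Lambda_rev.
apply: (tangent_exp_curve ops_ex); near=> t.
split=> i.
  have [_ ai] := (tangent_rootP z _).1 (hu i).
  have {}ai : Ad (q i) (tlifts q u i).2 = - (tlifts q u i).2 := ai.
  apply: exp_root_class => //; first by case: Lq.
  by rewrite AdZ ai scalerN.
move=> _; rewrite hr tinvE /= (Lambda_rev i Lq) invgM.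
(* With g = q_i^-1, the inverse of exp(ta) q_i is g exp(-ta) = exp(Ad g (-ta)) g, which is the
   exponential curve of the mirror strand. *)
set g := (q i)^-1%g; set a := (tlifts q u i).2.
have e : t *: (- Ad g a) = Ad g (- (t *: a)) by rewrite -scaleNr AdZ scaleNr scalerN.
have e' := lie_exp_Ad ops_ex g (- (t *: a)).
rewrite (lie_expN ops_ex) in e'.
have -> : lie_exp G (t *: (- Ad g a)) = (g * (lie_exp G (t *: a))^-1 * g^-1)%g.
  by rewrite e e'.
by rewrite mulgVK.
Unshelve. all: by end_near. Qed.

Variable dot : invariant_inner_product G.
Variables (U : set G) (O : set 'rV[R]_d).
Hypotheses (U_open : open U) (U1 : U 1%g) (O0 : O 0).
Hypothesis exp_inj : {in O &, injective (@lie_exp R d G)}.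
Let M : set Gm := class_pow C `&` r_map (m := m) @^-1` U.
Hypothesis M_form : two_form_on AGm M (omega_C dot O).
Hypothesis M_nondeg : nondegenerate_on AGm M (omega_C dot O).

Lemma Lambda_sub : Lambda C `<=` M.
Proof. by move=> q Lq; split; [case: Lq|rewrite /= Lambda_r]. Qed.

Section AtPoint.
Variable q : Gm.
Hypothesis Lq : Lambda C q.

Definition velocity u i : 'rV[R]_d := (tlifts q u i).2.
(** On vectors tangent to M this is the differential at [q] of the involution sending p to the tuple
    with i-th entry [(p (rev_ord i))^-1], whose fixed points in C^(2n) are Lambda. No sign appears
    because [(p, a)] with [Ad p a = - a] has inverse [(p^-1, a)]. *)
Definition reflect_tangent u : 'M[R]_(2 * n, d) :=
  \matrix_i right_translate (velocity u (rev_ord i)) (q i).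

Lemma velocity_lin (c : R) u v i :
  velocity (c *: u + v) i = c *: velocity u i + velocity v i.
Proof.
rewrite /velocity /tlifts /= linearP /mc_right /mdiff; exact: linearP.
Qed.

Lemma velocity_reflect u i : velocity (reflect_tangent u) i = velocity u (rev_ord i).
Proof. by rewrite {1}/velocity /tlifts rowK /= right_translateK. Qed.

Let qq i : (q i * q i = z)%g.
Proof. by apply: C_root; case: Lq. Qed.

Let qr i : q (rev_ord i) = (q i)^-1%g.
Proof. exact: Lambda_rev. Qed.

Lemma tangent_velocity u : tangent AGm M q u <->
  forall i, Ad (q i) (velocity u i) = - velocity u i.
Proof.
have [Cq Uq] := Lambda_sub Lq.
apply: (iff_trans (tangent_class_rootP C_root C_conj ops_ex u U_open Cq Uq)).
split=> h i; first by have [_] := (tangent_rootP z _).1 (h i).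
by apply/tangent_rootP; split; [exact: qq|exact: h].
Qed.

Lemma tangent_Lambda_velocity u : tangent AGm (Lambda C : set Gm) q u <->
  tangent AGm M q u /\ forall i, velocity u (rev_ord i) = velocity u i.
Proof.
have AdV i : tangent AGm M q u -> - Ad (q i)^-1%g (velocity u i) = velocity u i.
  move=> /tangent_velocity /(_ i) e.
  by rewrite -[LHS]AdN -e AdK.
have [Cq Uq] := Lambda_sub Lq.
have T := tangent_class_rootP C_root C_conj ops_ex u U_open Cq Uq.
split=> [/(tangent_LambdaP _ Lq)[hu hr]|[tu hr]].
  have tu : tangent AGm M q u by apply/T.
  by split=> // i; rewrite -[RHS](AdV i tu) {1}/velocity hr tinvE.
apply/(tangent_LambdaP _ Lq); split; first exact/T.
move=> i; rewrite tinvE; congr pair; first exact: qr.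
by rewrite -[LHS]/(velocity u (rev_ord i)) hr -[LHS](AdV i tu).
Qed.

Lemma tangent_lin (c : R) u v : tangent AGm M q u -> tangent AGm M q v ->
  tangent AGm M q (c *: u + v).
Proof.
move=> /tangent_velocity hu /tangent_velocity hv; apply/tangent_velocity => i.
by rewrite velocity_lin linear_Ad hu hv scalerN opprD.
Qed.

Lemma tangent_reflect u : tangent AGm M q u -> tangent AGm M q (reflect_tangent u).
Proof.
move=> /tangent_velocity hu; apply/tangent_velocity => i.
rewrite velocity_reflect.
have qi : q i = (q (rev_ord i))^-1%g by rewrite qr invgK.
have e := hu (rev_ord i); move: e; set X := velocity u _ => e.
have e' : Ad (q i) (- X) = X by rewrite -e qi -AdM mulVg Ad1.
by rewrite -[LHS]opprK -[- Ad _ _]AdN e'.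
Qed.

Lemma shift_sum_even u : tangent AGm (Lambda C : set Gm) q u ->
  forall j, (j <= m)%N ->
    shift_sum (tlifts q u) (m - j) = shift_sum (tlifts q u) j.
Proof.
move=> /(tangent_LambdaP _ Lq)[_ hr] j jm.
by rewrite /shift_sum (prefix_prod_rev hr jm).
Qed.

Lemma shift_sum_odd u : tangent AGm M q u ->
  (forall i, velocity u (rev_ord i) = - velocity u i) ->
  forall j, (j <= m)%N -> shift_sum (tlifts q u) (m - j) =
    shift_sum (tlifts q u) m - shift_sum (tlifts q u) j.
Proof.
by move=> /tangent_velocity hu hr; apply: shift_sum_revN.
Qed.

Lemma omega_pairing u v :
  omega_C dot O q u v = - (pairing dot (tlifts q u) (tlifts q v) / 2).
Proof. exact: (omega_C_pairing dot z_central _ _ O0 exp_inj qq (Lambda_r Lq)). Qed.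

Lemma Lambda_isotropic u v : tangent AGm (Lambda C : set Gm) q u ->
  tangent AGm (Lambda C : set Gm) q v -> omega_C dot O q u v = 0.
Proof.
move=> tu tv; rewrite omega_pairing pairing_rev ?mul0r ?oppr0 //.
- exact: shift_sum_even.
- exact: shift_sum_even.
Qed.

Lemma odd_isotropic u v : tangent AGm M q u -> tangent AGm M q v ->
  (forall i, velocity u (rev_ord i) = - velocity u i) ->
  (forall i, velocity v (rev_ord i) = - velocity v i) ->
  omega_C dot O q u v = 0.
Proof.
move=> tu tv hu hv; rewrite omega_pairing pairing_revN ?mul0r ?oppr0 //.
- exact: shift_sum_odd.
- exact: shift_sum_odd.
Qed.

(* [u] splits into parts fixed and negated by [reflect_tangent]. The two
   eigenspaces are isotropic, so if [u] annihilates the fixed one, its negated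
   part annihilates the whole tangent space of [M], and vanishes. *)
Lemma Lambda_maximal u : tangent AGm M q u ->
  (forall v, tangent AGm (Lambda C : set Gm) q v -> omega_C dot O q u v = 0) ->
  tangent AGm (Lambda C : set Gm) q u.
Proof.
move=> tu wu; have Mq := Lambda_sub Lq.
have [lin anti] := M_form.1 q Mq.
set w := omega_C dot O q in lin anti wu.
(* Twice the two projections; the coefficient is kept explicit to match the [c *: _ + _] form of the
   linearity lemmas. *)
pose odd u := (-1) *: reflect_tangent u + u.
pose even u := 1 *: reflect_tangent u + u.
have todd x : tangent AGm M q x -> tangent AGm M q (odd x).
  by move=> tx; apply: tangent_lin => //; exact: tangent_reflect.
have teven x : tangent AGm M q x -> tangent AGm M q (even x).
  by move=> tx; apply: tangent_lin => //; exact: tangent_reflect.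
have vodd x i : velocity (odd x) (rev_ord i) = - velocity (odd x) i.
  rewrite !velocity_lin !velocity_reflect rev_ordK !scaleN1r opprD opprK addrC.
  by [].
have veven x i : velocity (even x) (rev_ord i) = velocity (even x) i.
  by rewrite !velocity_lin !velocity_reflect rev_ordK !scale1r addrC.
have Leven x : tangent AGm M q x -> tangent AGm (Lambda C : set Gm) q (even x).
  by move=> tx; apply/tangent_Lambda_velocity; split; [exact: teven|exact: veven].
have linr c x y1 y2 : tangent AGm M q x -> tangent AGm M q y1 ->
    tangent AGm M q y2 -> w x (c *: y1 + y2) = c * w x y1 + w x y2.
  move=> tx t1 t2; rewrite anti //; last exact: tangent_lin.
  by rewrite lin // (anti y1 x) // (anti y2 x) // opprD mulrN !opprK.
have odd0 : odd u = 0.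
  apply: (M_nondeg Mq (todd u tu)) => v tv; rewrite -/w.
  have tou := todd u tu; have tev := teven v tv.
  have h1 : w (odd u) (odd v) = 0.
    by apply: odd_isotropic => //; exact: todd.
  have h2 : w (even u) (even v) = 0 by apply: Lambda_isotropic; exact: Leven.
  have h3 := wu _ (Leven v tv).
  (* Since [u] and [even u] both annihilate [even v], so does [odd u]; it also annihilates [odd v],
     and [odd v + even v] is twice [v]. *)
  have tru := tangent_reflect tu; have trv := tangent_reflect tv.
  rewrite lin // h3 in h2; rewrite linr // in h1.
  have h4 : w (odd u) (even v) = 0 by rewrite lin // h3; lra.
  rewrite linr // in h4; lra.
apply/tangent_Lambda_velocity; split=> // i.
have : velocity (odd u) i = 0.
  by rewrite odd0 /velocity /tlifts /= linear0 mc_right0.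
by rewrite velocity_lin velocity_reflect scaleN1r addrC => /eqP; rewrite subr_eq0 => /eqP.
Qed.

End AtPoint.

Lemma Lambda_lagrangian : submanifold AGm (Lambda C : set Gm) ->
  lagrangian_submanifold AGm M (omega_C dot O) (Lambda C : set Gm).
Proof.
move=> sL; split=> // [|q Lq]; first exact: Lambda_sub.
apply/seteqP; split=> [u tu|u [tu wu]]; last exact: Lambda_maximal.
split=> [|v tv]; last exact: Lambda_isotropic.
by have [] := (tangent_Lambda_velocity Lq u).1 tu.
Qed.

End LambdaTangent.

(** * A parametrization of Lambda *)

Section LambdaSubmanifold.
Variables (R : realType) (d : nat) (G : lieGroupType R d).
Local Notation AG := (@lie_charts R d G).
Local Notation Av := (vec_charts _).
Local Notation exp := (@lie_exp R d G).
Local Hint Resolve lie_regular : core.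

Variables (O : set 'rV[R]_d).
Hypotheses (O_open : open O) (O_Ad : Ad_invariant G O) (O0 : O 0).
Hypothesis O_star : star_shaped O.
Hypothesis O_exp : exp_diffeo G O.

Lemma exp_ops_ex X : exists c : R^o -> G, one_param_subgroup c X.
Proof. by case: O_exp => iO _ _ _; apply: ops_exists iO X. Qed.

Let exp_open : open (exp @` O).
Proof. by case: O_exp. Qed.

Lemma lie_logK g : (exp @` O) g -> O (lie_log O g) /\ exp (lie_log O g) = g.
Proof.
move=> [X OX <-]; rewrite /lie_log; case: xgetP => [Y _ //|/(_ X)].
by case.
Qed.

Lemma lie_expK X : O X -> lie_log O (exp X) = X.
Proof.
move=> OX; have [OY eY] := lie_logK (imageP exp OX).
by case: O_exp => iO _ _ _; apply: iO; rewrite ?inE.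
Qed.

Variables (C : set G) (z : G).
Hypothesis C_root : forall p, C p -> (p * p)%g = z.
Hypothesis C_conj : conj_invariant C.
Hypothesis C_inv : forall p, C p -> C (p^-1)%g.
Variable p0 : G.
Hypothesis C_p0 : forall p, C p <-> exists h, p = (h * p0 * h^-1)%g.

Let Cp0 : C p0.
Proof. by apply/C_p0; exists 1%g; rewrite mul1g invg1 mulg1. Qed.

(** Made symmetric so that [- X] also lies where [lie_exp] is injective, which allows [Ad p0 X] and
    [- X] to be compared through their exponentials. *)
Definition sym_open : set 'rV[R]_d := O `&` -%R @^-1` O.

Lemma sym_open_open : open sym_open.
Proof.
apply: openI => //; apply: open_comp => // x _.
apply: (linear_frame_continuous (mx_frame R 1 d)) => a u v.
by rewrite opprD scalerN.
Qed.

(* Comparing the two expressions of [z], conjugation by [p0] inverts [exp X],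
   that is [exp (Ad p0 X) = exp (- X)]. *)
Lemma exp_class_root X : sym_open X -> C (exp X * p0)%g -> Ad p0 X = - X.
Proof.
move=> [OX ONX] /C_root; rewrite -(C_root Cp0) => e.
have e1 : (p0 * exp X * p0^-1 = (exp X)^-1)%g.
  apply: (@mulgI _ (exp X)); rewrite mulgV.
  apply: (@mulIg _ (p0 * p0)%g); rewrite mul1g -[RHS]e.
  by rewrite !mulgA mulgVK.
case: O_exp => iO _ _ _; apply: iO; rewrite ?inE //; first exact: O_Ad.
by rewrite (lie_exp_Ad exp_ops_ex) e1 (lie_expN exp_ops_ex).
Qed.

(** The -1 eigenspace of [Ad p0] in row-vector convention, that is, the right-trivialized tangent
    space of C at [p0]. *)
Let K : 'M[R]_d := kermx (lin1_mx (Ad p0) + 1%:M).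
Definition antifixed_rank := \rank K.
Local Notation e := antifixed_rank.
Definition antifixed_basis : 'M[R]_(e, d) := row_base K.
Local Notation B := antifixed_basis.

Lemma antifixedP (X : 'rV[R]_d) : (X <= K)%MS <-> Ad p0 X = - X.
Proof.
rewrite -(rwP sub_kermxP) mulmxDr mulmx1 mul_rV_lin1 /=.
by split=> [/eqP|->]; rewrite ?addNr // addr_eq0 => /eqP.
Qed.

Lemma Ad_basis (y : 'rV[R]_e) : Ad p0 (y *m B) = - (y *m B).
Proof. by apply/antifixedP; rewrite -(eq_row_base K) submxMl. Qed.

Lemma basisKV (X : 'rV[R]_d) : Ad p0 X = - X -> X *m pinvmx B *m B = X.
Proof. by move=> /antifixedP XK; rewrite mulmxKpV // eq_row_base. Qed.

Lemma basisK (y : 'rV[R]_e) : y *m B *m pinvmx B = y.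
Proof. by rewrite mulmxKp // row_base_free. Qed.

Variable n : nat.
Local Notation Gm := {ptws 'I_(2 * n) -> G}.
Local Notation AGm := (pow_charts AG (2 * n)).
Local Notation E := 'rV[R]_(n * e).
Variable j0 : 'I_n.
Variable q : Gm.
Hypothesis Lq : Lambda C q.
Variable h : 'I_(2 * n) -> G.
Hypothesis hq : forall i, q i = (h i * p0 * (h i)^-1)%g.

(* junk value [j0] on the second half *)
Definition fst_half (i : 'I_(2 * n)) : 'I_n := insubd j0 (i : nat).
Definition to_half (j : 'I_n) : 'I_(2 * n) :=
  widen_ord (leq_pmull n (isT : (0 < 2)%N)) j.

Lemma to_halfK j : fst_half (to_half j) = j.
Proof. by apply: val_inj; rewrite val_insubd /= ltn_ord. Qed.

Lemma fst_halfK (i : 'I_(2 * n)) : (i < n)%N -> to_half (fst_half i) = i.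
Proof. by move=> i_n; apply: val_inj; rewrite /= val_insubd i_n. Qed.

Definition coord_vec (i : 'I_(2 * n)) (x : E) : 'rV[R]_d :=
  row (fst_half i) (vec_mx x) *m B.

Lemma linear_coord_vec i : linear (coord_vec i).
Proof. by move=> c x y; rewrite /coord_vec !linearP /= mulmxDl -scalemxAl. Qed.

Lemma coord_vec_continuous i : continuous (coord_vec i).
Proof. by apply: linear_frame_continuous (linear_coord_vec i); exact: mx_frame. Qed.

(** Every component is reached from the single base point [p0] through its conjugator [h i], so one
    eigenspace serves at all points. This yields the same parameter dimension everywhere, as
    [submanifold] demands. *)
Definition half_param (i : 'I_(2 * n)) (x : E) : G :=
  (h i * (exp (coord_vec i x) * p0) * (h i)^-1)%g.

Definition Lambda_param (x : E) : Gm := fun i =>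
  if (i < n)%N then half_param i x else (half_param (rev_ord i) x)^-1%g.

Definition param_dom : set E := [set x | forall i, sym_open (coord_vec i x)].

Lemma param_dom_open : open param_dom.
Proof.
rewrite openE => x Vx; rewrite /interior.
suff : \forall y \near x, forall i, sym_open (coord_vec i y) by [].
apply: near_forall => i; apply: (@coord_vec_continuous i x).
by apply: open_nbhs_nbhs; split; [exact: sym_open_open|exact: Vx].
Qed.

Definition untwist (i : 'I_(2 * n)) (g : G) : G := ((h i)^-1 * g * h i * p0^-1)%g.

Lemma untwist_param i x : untwist i (half_param i x) = exp (coord_vec i x).
Proof. by rewrite /untwist /half_param !mulgA mulVg mul1g mulgVK mulgK. Qed.

Lemma param_untwist i g x : exp (coord_vec i x) = untwist i g -> half_param i x = g.
Proof. by rewrite /half_param => ->; rewrite /untwist !mulgA mulgVK mulgV mul1g mulgK. Qed.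

Lemma Lambda_param_half (j : 'I_n) x :
  Lambda_param x (to_half j) = half_param (to_half j) x.
Proof. by rewrite /Lambda_param /= ltn_ord. Qed.

Lemma Lambda_param_rev x i :
  Lambda_param x (rev_ord i) = (Lambda_param x i)^-1%g.
Proof.
rewrite /Lambda_param rev_ordK /=.
have -> : (2 * n - i.+1 < n)%N = ~~ (i < n)%N by have := ltn_ord i; lia.
by case: (i < n)%N => //=; rewrite invgK.
Qed.

Lemma Lambda_param_in x : Lambda C (Lambda_param x).
Proof.
have Ch i : C (half_param i x).
  by apply: C_conj; apply: exp_root_class => //; [exact: exp_ops_ex|exact: Ad_basis].
split=> [i|i _]; last exact: Lambda_param_rev.
by rewrite /Lambda_param; case: ifP => _ //; exact: C_inv.
Qed.

Lemma half_param_smooth i x : param_dom x -> smooth_at Av AG (half_param i) x.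
Proof.
move=> Vx; have rx : regular_chart (vec_charts E) x by apply: vec_regular; exact: mx_frame.
have [OY _] := Vx i; case: O_exp => _ _ sexp _.
have [s _] := is_smooth_comp rx (vec_regular (coord_vec i x) (mx_frame R 1 d)) (erefl _)
  (is_smooth_linear x (mx_frame R 1 _) (linear_coord_vec i))
  (smooth_at_is_smooth (sexp _ OY)).
by do !apply: smooth_at_mul => //; exact: smooth_at_cst.
Qed.

Let rE (x : E) : regular_chart (vec_charts E) x.
Proof. by apply: vec_regular; exact: mx_frame. Qed.

Lemma Lambda_param_smooth : smooth_on (vec_charts E) AGm param_dom Lambda_param.
Proof.
move=> x Vx; have s i : smooth_at (vec_charts E) AG (fun y => Lambda_param y i) x.
  rewrite /Lambda_param; case: (i < n)%N; first exact: half_param_smooth.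
  by apply: smooth_at_inv => //; exact: half_param_smooth.
by have [] := is_smooth_ptws (f := Lambda_param) (fun i => smooth_at_is_smooth (s i)).
Qed.

Lemma smooth_untwist i : smooth_map (untwist i).
Proof.
move=> g; do !apply: smooth_at_mul => //; try exact: smooth_at_cst.
exact: smooth_map_id.
Qed.

Definition log_coord (j : 'I_n) (g : Gm) : 'rV[R]_d :=
  lie_log O (untwist (to_half j) (g (to_half j))).

Lemma log_coord_smooth j g : (exp @` O) (untwist (to_half j) (g (to_half j))) ->
  smooth_at AGm (vec_charts 'rV[R]_d) (log_coord j) g.
Proof.
move=> Og; case: O_exp => _ _ _ slog.
have s1 := is_smooth_comp (pow_lie_regular g) (lie_regular _) (erefl _)
  (smooth_at_is_smooth (smooth_proj g (to_half j)))
  (smooth_at_is_smooth (smooth_untwist (to_half j) (g (to_half j)))).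
by have [] := is_smooth_comp (pow_lie_regular g) (lie_regular _) (erefl _) s1
  (smooth_at_is_smooth (slog _ Og)).
Qed.

Lemma log_coord_param j x : param_dom x ->
  log_coord j (Lambda_param x) = coord_vec (to_half j) x.
Proof.
move=> Vx; have [OY _] := Vx (to_half j).
by rewrite /log_coord Lambda_param_half untwist_param lie_expK.
Qed.

(** A left inverse of [Lambda_param], continuous on an open part of the whole power of G and not
    merely on Lambda; the open sets cutting out images of the parametrization come from it. *)
Definition Lambda_coord (g : Gm) : E := mxvec (\matrix_j (log_coord j g *m pinvmx B)).

Lemma Lambda_coordK x : param_dom x -> Lambda_coord (Lambda_param x) = x.
Proof.
move=> Vx; rewrite -[RHS]vec_mxK; congr mxvec; apply/row_matrixP => j.
by rewrite rowK log_coord_param // basisK to_halfK.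
Qed.

Lemma Lambda_coord_continuous (g : Gm) :
  (forall j, (exp @` O) (untwist (to_half j) (g (to_half j)))) ->
  continuous_at g Lambda_coord.
Proof.
move=> Og.
have lm : linear (mxvec : 'M[R]_(n, e) -> E) by move=> a u v; rewrite linearP.
apply: (@continuous_comp _ _ _ (fun g : Gm => \matrix_j (log_coord j g *m pinvmx B)) mxvec).
  apply: rows_continuous => j.
  have lp : linear (fun X : 'rV[R]_d => X *m pinvmx B).
    by move=> a u v; rewrite mulmxDl scalemxAl.
  apply: (@continuous_comp _ _ _ (log_coord j) (fun X : 'rV[R]_d => X *m pinvmx B)).
    by have [] := log_coord_smooth (Og j).
  exact: (linear_frame_continuous (mx_frame R 1 d) lp).
exact: (linear_frame_continuous (mx_frame R n e) lm).
Qed.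

Lemma Lambda_local_param : local_param AGm (Lambda C) param_dom Lambda_param.
Proof.
split; first exact: param_dom_open.
- exact: Lambda_param_smooth.
- move=> x Vx u v uv.
  (* Followed by [log_coord j] the parametrization becomes the linear map [coord_vec], so its
     differential determines these vectors. *)
  suff huv j : coord_vec (to_half j) u = coord_vec (to_half j) v.
    rewrite -[u]vec_mxK -[v]vec_mxK; congr mxvec; apply/row_matrixP => j.
    have := huv j; rewrite /coord_vec to_halfK => /(congr1 (mulmx^~ (pinvmx B))).
    by rewrite !basisK.
  have Og : (exp @` O) (untwist (to_half j) (Lambda_param x (to_half j))).
    rewrite Lambda_param_half untwist_param; apply: imageP.
    by have [] := Vx (to_half j).
  have sc := is_smooth_comp (rE x) (pow_lie_regular _) (erefl _)
    (smooth_at_is_smooth (Lambda_param_smooth Vx))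
    (smooth_at_is_smooth (log_coord_smooth Og)).
  have ne : \forall y \near x, (log_coord j \o Lambda_param) y = coord_vec (to_half j) y.
    have Vn : \forall y \near x, param_dom y.
      by apply: open_nbhs_nbhs; split; [exact: param_dom_open|].
    by apply: filterS Vn => y; exact: log_coord_param.
  have [_ h1] := is_smooth_near (rE x) ne sc.
  have [_ h2] := is_smooth_linear x (mx_frame R 1 _) (linear_coord_vec (to_half j)).
  by rewrite -!h2 !h1 /= uv.
- move=> x y /set_mem Vx /set_mem Vy xy.
  by rewrite -(Lambda_coordK Vx) xy Lambda_coordK.
move=> V' oV' V'V.
(* Besides the coordinates lying in [V'], the logarithms must lie in [sym_open], so that
   [exp_class_root] applies to every point of Lambda in this set. *)
exists [set g : Gm | (forall j, (exp @` O) (untwist (to_half j) (g (to_half j))) /\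
    sym_open (log_coord j g)) /\ V' (Lambda_coord g)].
  rewrite openE => g [hg Vg]; rewrite /interior.
  have Og j : (exp @` O) (untwist (to_half j) (g (to_half j))) by have [] := hg j.
  have n1 : \forall y \near g, forall j,
      (exp @` O) (untwist (to_half j) (y (to_half j))) /\ sym_open (log_coord j y).
    apply: near_forall => j; apply: filterI.
      have [c1 _] := smooth_untwist (to_half j) (g (to_half j)).
      have := c1 _ (open_nbhs_nbhs (conj exp_open (Og j))).
      exact: proj_near.
    have [c2 _] := log_coord_smooth (Og j).
    by apply: c2; apply: open_nbhs_nbhs; split; [exact: sym_open_open|have [] := hg j].
  have n2 : \forall y \near g, V' (Lambda_coord y).
    by apply: (Lambda_coord_continuous Og); apply: open_nbhs_nbhs.
  by near=> y; split; near: y.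
apply/seteqP; split=> [_ [x Vx' <-]|g [Lg [hg Vg]]].
  have Vx := V'V x Vx'; split; first exact: Lambda_param_in.
  split=> [j|]; last by rewrite /= Lambda_coordK.
  rewrite log_coord_param // Lambda_param_half untwist_param; split; last exact: Vx.
  by apply: imageP; have [] := Vx (to_half j).
exists (Lambda_coord g) => //; apply/funext => i.
(* As [g k] lies in C, the logarithm of its untwisted form is in the -1 eigenspace, so passing to
   coordinates by [pinvmx] and back recovers it. *)
have half_eq (k : 'I_(2 * n)) : (k < n)%N -> half_param k (Lambda_coord g) = g k.
  move=> kn; have [Og Sg] := hg (fst_half k).
  rewrite fst_halfK // in Og.
  have [OX eX] := lie_logK Og.
  have lE : log_coord (fst_half k) g = lie_log O (untwist k (g k)).
    by rewrite /log_coord fst_halfK.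
  rewrite lE in Sg.
  apply: param_untwist; rewrite -eX /coord_vec /Lambda_coord mxvecK rowK lE.
  rewrite basisKV //; apply: exp_class_root => //.
  rewrite eX /untwist mulgVK.
  by have := C_conj (h k)^-1%g (proj1 Lg k); rewrite invgK.
rewrite /Lambda_param; case: ifPn => [i_n|]; first exact: half_eq.
rewrite -leqNgt => ni; rewrite half_eq; last by rewrite /=; have := ltn_ord i; lia.
by rewrite (Lambda_rev _ Lg) invgK.
Unshelve. all: by end_near. Qed.

Lemma Lambda_param0 : param_dom 0 /\ Lambda_param 0 = q.
Proof.
have c0 i : coord_vec i 0 = 0 by rewrite /coord_vec !linear0 mul0mx.
split=> [i|]; first by rewrite c0; split => //=; rewrite oppr0.
have hp i : half_param i 0 = q i by rewrite /half_param c0 lie_exp0 mul1g hq.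
apply/funext => i; rewrite /Lambda_param !hp; case: ifP => // _.
by rewrite (Lambda_rev _ Lq) invgK.
Qed.

End LambdaSubmanifold.

(** * The braid action *)

Section BraidAction.
Variables (R : realType) (d : nat) (G : lieGroupType R d).
Local Notation AG := (@lie_charts R d G).

Lemma word_act_invK m (w : braid_word m) (g : 'I_m -> G) :
  word_act w (word_act (word_inv w) g) = g.
Proof.
rewrite -word_act_cat -{1}[w]word_invK.
exact: (word_act_rel g (word_invV (word_inv w))).
Qed.

Lemma word_act_Kinv m (w : braid_word m) (g : 'I_m -> G) :
  word_act (word_inv w) (word_act w g) = g.
Proof. by rewrite -word_act_cat; exact: (word_act_rel g (word_invV w)). Qed.

Lemma word_act_class (C : set G) m (w : braid_word m) g :
  conj_invariant C -> class_pow C g -> class_pow C (word_act w g).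
Proof.
move=> cC Cg; elim: w => [//|l w IH] i /=; rewrite /letter_act.
case: ifP => _; first by case: l.2; [exact: cC|exact: IH].
case: ifP => _; last exact: IH.
case: l.2; first exact: IH.
by have := cC _ (word_act w g (strand_hi l.1))^-1%g (IH (strand_lo l.1)); rewrite invgK.
Qed.

Lemma word_act_level (C : set G) (U : set G) m (w : braid_word m) :
  conj_invariant C ->
  (word_act w : {ptws 'I_m -> G} -> {ptws 'I_m -> G}) @`
    (class_pow C `&` r_map (m := m) @^-1` U) =
  class_pow C `&` r_map (m := m) @^-1` U.
Proof.
move=> cC.
have sub w' g : (class_pow C `&` r_map (m := m) @^-1` U) g ->
    (class_pow C `&` r_map (m := m) @^-1` U) (word_act w' g).
  by move=> [Cg Ug]; split; [exact: word_act_class|rewrite /= /r_map prod_word_act].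
apply/seteqP; split=> [_ [g Mg <-]|g Mg]; first exact: sub.
by exists (word_act (word_inv w) g); [exact: sub|exact: word_act_invK].
Qed.

End BraidAction.

(** * Transport of Lambda by the braid *)

Theorem corollary5p3 (R : realType) (d : nat) (G : lieGroupType R d)
    (G_compact : compact [set: G])
    (dot : invariant_inner_product G)
    (n : nat) (n_ge1 : (1 <= n)%N)
    (C : set G) (C_class : conjugacy_class C)
    (C_sqr : forall p, C p -> in_center (p ^+ 2)%g)
    (C_inv : C = [set g | C (g^-1)%g])
    (O : set 'rV[R]_d)
    (O_open : open O) (O_Ad : Ad_invariant G O)
    (O_0 : O 0) (O_star : star_shaped O)
    (O_exp : exp_diffeo G O)
    (U : set G)
    (U_open : open U) (U_1 : U 1%g) (U_conj : conj_invariant U)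
    (M : set {ptws 'I_(2 * n) -> G})
    (M_def : M = class_pow C `&` @r_map R d G (2 * n) @^-1` U)
    (M_sub : M `<=` @r_map R d G (2 * n) @^-1` (@lie_exp R d G @` O))
    (M_symplectic :
       symplectic_manifold (pow_charts (@lie_charts R d G) (2 * n)) M
         (omega_C dot O))
    (sigma : braid n) :
  lagrangian_submanifold (pow_charts (@lie_charts R d G) (2 * n)) M
    (omega_C dot O)
    (braid_act (braid_shift sigma) @` Lambda C).
Proof.
have [p0 CE] := C_class.
have C_p0 p : C p <-> exists h, p = (h * p0 * h^-1)%g.
  by rewrite {1}CE; split=> [[h _ <-]|[h ->]]; [exists h|exists h].
have Cp0 : C p0 by apply/C_p0; exists 1%g; rewrite mul1g invg1 mulg1.
pose z := (p0 * p0)%g; have zc : in_center z := C_sqr _ Cp0.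
(* The square of h p0 h^-1 is h z h^-1, which equals [z] by centrality. *)
have C_root p : C p -> (p * p)%g = z.
  by move=> /C_p0[h ->]; rewrite conj_square -(zc h) mulgK.
have C_conj : conj_invariant C.
  move=> p h /C_p0[h' ->]; apply/C_p0; exists (h * h')%g.
  by rewrite invgM !mulgA.
have C_V p : C p -> C p^-1%g.
  have e : C p = C p^-1%g := congr1 (fun S : set G => S p) C_inv.
  by rewrite -e.
have [exp_inj _ _ _] := O_exp.
have ops_ex := exp_ops_ex O_open O_0 O_star O_exp.
have [_ M_form _ M_nondeg] := M_symplectic; rewrite M_def in M_form M_nondeg *.
have sL : submanifold (pow_charts (@lie_charts R d G) (2 * n)) (Lambda C).
  exists (n * antifixed_rank p0)%N => q Lq.
  have /choice[h hq] i : exists h, q i = (h * p0 * h^-1)%g.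
    by apply/C_p0; case: Lq.
  have [V0 eq0] := Lambda_param0 O_0 (Ordinal n_ge1) Lq hq.
  exists (param_dom O (p0 := p0) (Ordinal n_ge1)),
    (Lambda_param (p0 := p0) (Ordinal n_ge1) h).
  split; last by exists 0.
  exact: (Lambda_local_param O_open O_Ad O_0 O_star O_exp C_root C_conj C_V C_p0 (Ordinal n_ge1) h).
set w := repr (braid_shift sigma).
have lag := Lambda_lagrangian zc C_root C_conj ops_ex U_open U_1 O_0 exp_inj M_form M_nondeg sL.
apply: (@lagrangian_image _ _ _ _ (@pow_lie_regular _ _ _ _) _ (word_act (word_inv w))
   (word_act_Kinv w) (word_act_invK w) (smooth_word w) (smooth_word (word_inv w))) lag.
  exact: word_act_level.
move=> p u v Lp tu tv; have Cp : class_pow C p by case: Lp.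
have ru := fun i => tangent_class_root C_root i (@subIsetl _ _ _) tu.
have rv := fun i => tangent_class_root C_root i (@subIsetl _ _ _) tv.
have Cw : class_pow C (word_act w p) by exact: word_act_class.
(* The braid preserves the total product, so omega_C is given by [pairing] both at [p] and at its
   image. *)
have rp : r_map p = 1%g by exact: Lambda_r Lp.
rewrite (omega_C_pairing dot zc u v O_0 exp_inj (fun i => C_root _ (Cp i)) rp).
rewrite (omega_C_pairing dot zc _ _ O_0 exp_inj (fun i => C_root _ (Cw i))); last first.
  by rewrite /r_map prod_word_act.
by rewrite !tlifts_word (pairing_word dot zc).
Qed.
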